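(* Let $q$ be a prime power, let $L$ be a line in $\mathrm{PG}(5,q)$, and let $i\in\{0,1,2,3,q+1\}$. Then $L$ intersects the secant variety of the Veronese surface $\mathcal V(\mathbb F_q)$ in exactly $i$ points if and only if the cubic surface associated with $L$ has exactly $q^2+iq+1$ points (in $\mathrm{PG}(3,q)$).
   Context: A point $(y_0,\dots,y_5)$ of $\mathrm{PG}(5,q)$ is identified with the nonzero symmetric matrix $\begin{bmatrix} y_0&y_1&y_2\\ y_1&y_3&y_4\\ y_2&y_4&y_5\end{bmatrix}$ up to scalar, and its rank is the rank of this matrix. The Veronese surface $\mathcal V(\mathbb F_q)$ is the set of points of rank 1, and the points of its secant variety are the points of rank at most 2. A quadratic form $f=\sum_{0\le i\le j\le 2}a_{ij}X_iX_j$ corresponds to the hyperplane $a_{00}Y_0+a_{01}Y_1+a_{02}Y_2+a_{11}Y_3+a_{12}Y_4+a_{22}Y_5=0$ of $\mathrm{PG}(5,q)$. The quadratic forms whose hyperplanes contain a given line $L$ form (with $0$) a 4-dimensional vector space; let $f_1,f_2,f_3,f_4$ be a basis of it (so $\mathcal W=(f_1,f_2,f_3,f_4)$ is the web of conics associated with $L$). The discriminant of $f$ is $\Delta_f=4a_{00}a_{11}a_{22}+a_{01}a_{02}a_{12}-a_{00}a_{12}^2-a_{11}a_{02}^2-a_{22}a_{01}^2$. The cubic surface associated with $L$ is the zero locus in $\mathrm{PG}(3,q)$ of the cubic form $\Delta_f\in\mathbb F_q[A,B,C,D]$, where $f=Af_1+Bf_2+Cf_3+Df_4$; it is well defined up to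 projectivity. *)

(* Defs.v *)
From HB Require Import structures.
From mathcomp Require Export all_boot all_order all_algebra.
From mathcomp Require Export mpoly.
From mathcomp Require Import ring.
Set Implicit Arguments. Unset Strict Implicit. Unset Printing Implicit Defensive.
Import GRing.Theory.
Local Open Scope ring_scope.

(* Numerals of type 'I_3 and 'I_6 below are the ordinals themselves, obtained
   from the ring structure of 'I_n.+2 (integers mod n.+2). *)

(* A point of PG(n,q) is a one-dimensional subspace of F^(n+1), represented by
   the finite set of its vectors so that sets of points have a cardinal. *)
Definition ppoint (F : finFieldType) (n : nat) (v : 'rV[F]_n.+1) :
  {set 'rV[F]_n.+1} := [set a *: v | a : F].

Definition ppoints (F : finFieldType) (n : nat) (L : {vspace 'rV[F]_n.+1}) :
  {set {set 'rV[F]_n.+1}} :=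
  [set ppoint v | v : 'rV[F]_n.+1 & (v != 0) && (v \in L)].

(* Meaningful for homogeneous p, for which vanishing at v only depends on the
   point spanned by v. *)
Definition zero_locus (F : finFieldType) (n : nat) (p : {mpoly F[n.+1]}) :
  {set {set 'rV[F]_n.+1}} :=
  [set ppoint v | v : 'rV[F]_n.+1 & (v != 0) && (p.@[fun i => v 0 i] == 0)].

Definition symmx (R : nzRingType) (y : 'rV[R]_6) : 'M[R]_3 :=
  \matrix_(i, j) y 0 (nth 0 (nth [::] [:: [:: 0; 1; 2];
                                          [:: 1; 3; 4];
                                          [:: 2; 4; 5]] i) j).

Definition secant_variety (F : finFieldType) : {set {set 'rV[F]_6}} :=
  [set ppoint y | y : 'rV[F]_6 & (y != 0) && (\rank (symmx y) <= 2)%N].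

(* The coefficient of X_i X_j, which is that of X_i ^ 2 for i = j. *)
Definition qcoef (R : nzRingType) (f : {mpoly R[3]}) (i j : 'I_3) : R :=
  f@_(U_(i) + U_(j))%MM.

Definition hypeval (R : nzRingType) (f : {mpoly R[3]}) (y : 'rV[R]_6) : R :=
  qcoef f 0 0 * y 0 0 + qcoef f 0 1 * y 0 1 + qcoef f 0 2 * y 0 2
  + qcoef f 1 1 * y 0 3 + qcoef f 1 2 * y 0 4 + qcoef f 2 2 * y 0 5.

Definition discr (R : nzRingType) (f : {mpoly R[3]}) : R :=
  4%:R * qcoef f 0 0 * qcoef f 1 1 * qcoef f 2 2
  + qcoef f 0 1 * qcoef f 0 2 * qcoef f 1 2
  - qcoef f 0 0 * qcoef f 1 2 ^+ 2
  - qcoef f 1 1 * qcoef f 0 2 ^+ 2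
  - qcoef f 2 2 * qcoef f 0 1 ^+ 2.

(* Ternary quadratic forms over F, including 0. *)
Notation qform F := (dhomog 3 F 2).

Definition hypform (F : finFieldType) (y : 'rV[F]_6) (f : qform F) : F^o :=
  hypeval f y.

Fact hypform_is_linear (F : finFieldType) (y : 'rV[F]_6) : linear (hypform y).
Proof.
move=> a f g; rewrite /hypform /hypeval /qcoef linearP /= !mcoeffD !mcoeffZ.
by rewrite /GRing.scale /=; ring.
Qed.

HB.instance Definition _ (F : finFieldType) (y : 'rV[F]_6) :=
  GRing.isLinear.Build F (qform F) F^o _ (hypform y) (hypform_is_linear y).

(* The quadratic forms whose hyperplanes contain L; see mem_web. *)
Definition web (F : finFieldType) (L : {vspace 'rV[F]_6}) :
  {vspace (qform F)} :=
  (\bigcap_(y : 'rV[F]_6 | y \in L) lker (linfun (hypform y)))%VS.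

Lemma mem_web (F : finFieldType) (L : {vspace 'rV[F]_6}) (f : qform F) :
  reflect (forall y : 'rV[F]_6, y \in L -> hypeval f y = 0) (f \in web L).
Proof.
apply: (iffP idP) => [fW y yL | fL].
  move/subv_bigcapP: fW => /(_ y yL).
  by rewrite -memvE memv_ker lfunE => /eqP.
apply/subv_bigcapP => y yL; rewrite -memvE memv_ker lfunE; exact/eqP/fL.
Qed.

(* A f_1 + B f_2 + C f_3 + D f_4 as a quadratic form over F[A,B,C,D]. *)
Definition generic_form (F : finFieldType) (fs : 4.-tuple (qform F)) :
  {mpoly {mpoly F[4]}[3]} :=
  \sum_(k < 4) ('X_k : {mpoly F[4]}) *: map_mpoly (@mpolyC 4 F) (tnth fs k).

Definition cubic_surface (F : finFieldType) (fs : 4.-tuple (qform F)) :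
  {set {set 'rV[F]_4}} := zero_locus (discr (generic_form fs)).

(* Main.v *)
Require Import Defs.
From mathcomp Require Import all_boot all_order all_algebra.
From mathcomp Require Import mpoly.
From mathcomp Require Import finalg ring zify.
Set Implicit Arguments. Unset Strict Implicit. Unset Printing Implicit Defensive.
Import GRing.Theory.
Local Open Scope ring_scope.

(* In fact the cubic surface always has q^2 + n q + 1 points, where n is the
   number of points of rank at most 2 on L.  Count the pairs (f, x) with f in
   the web and x a singular vector of f.  A nonzero form f has only the singular
   vector 0 if its discriminant is nonzero, q^2 singular vectors if f is a
   scalar multiple of a square, and q otherwise.  The forms singular at x <> 0
   are those in the linear forms vanishing at x, so by duality (row rank =
   column rank) the number of those in the web is q times the number of M in L
   whose bilinear form vanishes on the plane orthogonal to x.  On the other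
   hand, for M <> 0 the number of zeros of x M x^T is q^2 if det M <> 0, when no
   such plane exists, and otherwise q + q t where t is the number of x <> 0 as
   above.  Summing over L and comparing with the number of squares in the web,
   which are the common zeros of the x M x^T, eliminates everything but the
   two required numbers. *)

(** * Sums and case analysis over ['I_3] and ['I_6] *)

Lemma big_ord3 (R : nmodType) (f : 'I_3 -> R) :
  \sum_(i < 3) f i = f 0 + f 1 + f 2.
Proof.
by rewrite !big_ord_recr big_ord0 /= add0r; congr (f _ + f _ + f _); apply/val_inj.
Qed.

Lemma big_ord6 (R : nmodType) (f : 'I_6 -> R) :
  \sum_(i < 6) f i = f 0 + f 1 + f 2 + f 3 + f 4 + f 5.
Proof.
rewrite !big_ord_recr big_ord0 /= add0r.
by congr (f _ + f _ + f _ + f _ + f _ + f _); apply/val_inj.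
Qed.

Lemma forall_ord3 (P : 'I_3 -> Prop) : P 0 -> P 1 -> P 2 -> forall i, P i.
Proof.
move=> P0 P1 P2 [[|[|[|//]]] lti].
- by rewrite (_ : Ordinal lti = 0) //; apply/val_inj.
- by rewrite (_ : Ordinal lti = 1) //; apply/val_inj.
- by rewrite (_ : Ordinal lti = 2) //; apply/val_inj.
Qed.

Lemma forall_ord6 (P : 'I_6 -> Prop) :
  P 0 -> P 1 -> P 2 -> P 3 -> P 4 -> P 5 -> forall i, P i.
Proof.
move=> P0 P1 P2 P3 P4 P5 [[|[|[|[|[|[|//]]]]]] lti].
- by rewrite (_ : Ordinal lti = 0) //; apply/val_inj.
- by rewrite (_ : Ordinal lti = 1) //; apply/val_inj.
- by rewrite (_ : Ordinal lti = 2) //; apply/val_inj.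
- by rewrite (_ : Ordinal lti = 3) //; apply/val_inj.
- by rewrite (_ : Ordinal lti = 4) //; apply/val_inj.
- by rewrite (_ : Ordinal lti = 5) //; apply/val_inj.
Qed.

(** * Linear algebra over a finite field *)

Section Linear.
Variable F : finFieldType.

Lemma card_rowspace m n (A : 'M[F]_(m, n)) :
  #|[set u : 'rV[F]_n | (u <= A)%MS]| = (#|F| ^ \rank A)%N.
Proof.
have injB : injective (fun u : 'rV[F]_(\rank A) => u *m row_base A).
  exact: row_free_inj (row_base_free A).
rewrite -[in RHS](mul1n (\rank A)) -card_mx -cardsT -(card_imset _ injB).
apply: eq_card => u; rewrite inE -(eq_row_base A).
by apply/submxP/imsetP => [[w ->]|[w _ ->]]; exists w.
Qed.

Lemma card_row_kernel m n (A : 'M[F]_(m, n)) :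
  #|[set u : 'rV[F]_m | u *m A == 0]| = (#|F| ^ (m - \rank A))%N.
Proof.
by rewrite -mxrank_ker -card_rowspace; apply: eq_card => u; rewrite !inE sub_kermx.
Qed.

Lemma row_ebase_sub m n (A : 'M[F]_(m, n)) (i : 'I_n) :
  (i < \rank A)%N -> (row i (row_ebase A) <= A)%MS.
Proof.
move=> lti; rewrite -(eq_row_base A).
suff -> : row i (row_ebase A) = row (Ordinal lti) (row_base A) by apply: row_sub.
rewrite /row_base row_mul; apply/rowP => j; rewrite !mxE (bigD1 i) //= big1.
  by rewrite !mxE eqxx lti mul1r addr0.
move=> k kni; rewrite !mxE /= (_ : (i == k :> nat) = false) ?mul0r //.
by apply/negbTE; rewrite eq_sym.
Qed.

(** [row_ebase x] is invertible, and its first row lies in the row space of [x], so rescaling turns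
    that row into [x]. *)
Lemma complete_row n (x : 'rV[F]_n.+1) :
  x != 0 -> exists2 g : 'M[F]_n.+1, g \in unitmx & row 0 g = x.
Proof.
move=> x0; have rx : \rank x = 1%N by rewrite rank_rV x0.
have /sub_rVP[c Ec] : (row 0 (row_ebase x) <= x)%MS by apply: row_ebase_sub; rewrite rx.
have c0 : c != 0.
  apply: contraTneq (row_ebase_unit x) => c0; rewrite -row_free_unit.
  apply/negP => /row_freeP[B /(congr1 (row 0))]; rewrite row_mul Ec c0 scale0r mul0mx.
  by move/rowP/(_ 0); rewrite !mxE eqxx => /esym/eqP; rewrite oner_eq0.
exists (c^-1 *: row_ebase x); first by rewrite unitmxZ ?row_ebase_unit // unitfE invr_eq0.
by rewrite linearZ /= Ec scalerA mulVf // scale1r.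
Qed.
End Linear.

(** * Ternary quadratic forms and their singular vectors *)

Section Forms.
Variable F : finFieldType.
Implicit Types (a b y : 'rV[F]_6) (l m u v x : 'rV[F]_3).

Definition row3 (s t r : F) : 'rV[F]_3 := \row_j nth 0 [:: s; t; r] j.

(* A quadratic form is represented by the row of its coefficients
   a00, a01, a02, a11, a12, a22, in the order of the coordinates in hypeval. *)
Definition fev a x : F :=
  a 0 0 * x 0 0 ^+ 2 + a 0 1 * (x 0 0 * x 0 1) + a 0 2 * (x 0 0 * x 0 2)
  + a 0 3 * x 0 1 ^+ 2 + a 0 4 * (x 0 1 * x 0 2) + a 0 5 * x 0 2 ^+ 2.

Definition grad a x : 'rV[F]_3 :=
  row3 (2%:R * a 0 0 * x 0 0 + a 0 1 * x 0 1 + a 0 2 * x 0 2)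
       (a 0 1 * x 0 0 + 2%:R * a 0 3 * x 0 1 + a 0 4 * x 0 2)
       (a 0 2 * x 0 0 + a 0 4 * x 0 1 + 2%:R * a 0 5 * x 0 2).

(* In characteristic 2 the vanishing of the gradient does not imply that of
   the form. *)
Definition sing a x : bool := (fev a x == 0) && (grad a x == 0).

Definition dsc a : F :=
  4%:R * a 0 0 * a 0 3 * a 0 5 + a 0 1 * a 0 2 * a 0 4
  - a 0 0 * a 0 4 ^+ 2 - a 0 3 * a 0 2 ^+ 2 - a 0 5 * a 0 1 ^+ 2.

Definition dot l x : F := (l *m x^T) 0 0.

(** The coefficient row of the product of two linear forms, each given by its own coefficient
    row. *)
Definition prodf l m : 'rV[F]_6 :=
  \row_j nth 0 [:: l 0 0 * m 0 0; l 0 0 * m 0 1 + l 0 1 * m 0 0;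
                   l 0 0 * m 0 2 + l 0 2 * m 0 0; l 0 1 * m 0 1;
                   l 0 1 * m 0 2 + l 0 2 * m 0 1; l 0 2 * m 0 2] j.

Lemma row3E s t r :
  (row3 s t r 0 0 = s) * (row3 s t r 0 1 = t) * (row3 s t r 0 2 = r).
Proof. by rewrite !mxE. Qed.

Lemma prodfE l m :
  (prodf l m 0 0 = l 0 0 * m 0 0)
  * (prodf l m 0 1 = l 0 0 * m 0 1 + l 0 1 * m 0 0)
  * (prodf l m 0 2 = l 0 0 * m 0 2 + l 0 2 * m 0 0)
  * (prodf l m 0 3 = l 0 1 * m 0 1)
  * (prodf l m 0 4 = l 0 1 * m 0 2 + l 0 2 * m 0 1)
  * (prodf l m 0 5 = l 0 2 * m 0 2).
Proof. by rewrite !mxE. Qed.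

Lemma dotE l x : dot l x = l 0 0 * x 0 0 + l 0 1 * x 0 1 + l 0 2 * x 0 2.
Proof. by rewrite /dot mxE big_ord3 !mxE. Qed.

Lemma symmxE y :
  (symmx y 0 0 = y 0 0) * (symmx y 0 1 = y 0 1) * (symmx y 0 2 = y 0 2)
  * (symmx y 1 0 = y 0 1) * (symmx y 1 1 = y 0 3) * (symmx y 1 2 = y 0 4)
  * (symmx y 2 0 = y 0 2) * (symmx y 2 1 = y 0 4) * (symmx y 2 2 = y 0 5).
Proof. by rewrite !mxE. Qed.

Lemma mx11_eq0 (A : 'M[F]_1) : (A == 0) = (A 0 0 == 0).
Proof.
apply/eqP/eqP => [->|A0]; first by rewrite mxE.
by apply/matrixP => i j; rewrite !ord1 A0 mxE.
Qed.

Lemma rV3P (u v : 'rV[F]_3) :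
  u 0 0 = v 0 0 -> u 0 1 = v 0 1 -> u 0 2 = v 0 2 -> u = v.
Proof. by move=> *; apply/rowP; apply: forall_ord3. Qed.

Lemma rV3_eq0 u : (u == 0) = [&& u 0 0 == 0, u 0 1 == 0 & u 0 2 == 0].
Proof.
apply/eqP/and3P => [->|[/eqP u0 /eqP u1 /eqP u2]]; first by rewrite !mxE.
by apply: rV3P; rewrite mxE.
Qed.

Lemma fev_prodf l m x : fev (prodf l m) x = dot l x * dot m x.
Proof. by rewrite /fev !prodfE !dotE; ring. Qed.

Lemma fevZ a c x : fev (c *: a) x = c * fev a x.
Proof. by rewrite /fev !mxE; ring. Qed.

Lemma fevD a b x : fev (a + b) x = fev a x + fev b x.
Proof. by rewrite /fev !mxE; ring. Qed.

(** [dot (grad a x) v] is the polar form of [a], so this expansion holds in every characteristic. *)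
Lemma fev_arg a t x v :
  fev a (t *: x + v) = t ^+ 2 * fev a x + t * dot (grad a x) v + fev a v.
Proof. by rewrite /fev dotE !row3E !mxE; ring. Qed.

Lemma fevZr a t x : fev a (t *: x) = t ^+ 2 * fev a x.
Proof. by rewrite /fev !mxE; ring. Qed.

Lemma gradZ a c x : grad (c *: a) x = c *: grad a x.
Proof. by apply: rV3P; rewrite !(row3E, mxE) /=; ring. Qed.

Lemma grad_arg a t x v : grad a (t *: x + v) = t *: grad a x + grad a v.
Proof. by apply: rV3P; rewrite !(row3E, mxE) /=; ring. Qed.

Lemma grad_prodf l m x : grad (prodf l m) x = dot l x *: m + dot m x *: l.
Proof.
by apply: rV3P; rewrite row3E !prodfE 3!mxE !dotE; ring.
Qed.

Lemma sing_arg_linear a t x v : sing a x -> sing a v -> sing a (t *: x + v).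
Proof.
move=> /andP[/eqP fx /eqP gx] /andP[/eqP fv /eqP gv]; rewrite /sing.
rewrite fev_arg grad_arg fx gx fv gv dotE !mxE.
by apply/andP; split; apply/eqP; [ring|rewrite scaler0 addr0].
Qed.

Lemma sing0 a : sing a 0.
Proof.
have -> : 0 = 0 *: 0 + 0 :> 'rV[F]_3 by rewrite scaler0 addr0.
apply/andP; split; first by rewrite /fev !mxE; apply/eqP; ring.
by apply/eqP/rV3P; rewrite !(row3E, mxE) /=; ring.
Qed.

Lemma sing_arg a x v t : sing a x -> fev a (t *: x + v) = fev a v.
Proof.
by move=> /andP[/eqP fx /eqP gx]; rewrite fev_arg fx gx dotE !mxE; ring.
Qed.

(** The values at the unit vectors give the coefficients of the squares, and those at sums of two
    unit vectors then give the mixed ones. This works even over the field with two elements. *)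
Lemma fev_inj a b : fev a =1 fev b -> a = b.
Proof.
move=> eab; pose e s t r := eab (row3 s t r).
move: (e 1 0 0) (e 0 1 0) (e 0 0 1) (e 1 1 0) (e 1 0 1) (e 0 1 1).
rewrite /fev !row3E !(expr1n, expr0n, mul0r, mulr0, mulr1, addr0, add0r) /=.
move=> e0 e3 e5 e1 e2 e4.
apply/rowP; apply: forall_ord6 => //.
- by move: e1; rewrite e0 e3 => /addIr/addrI.
- by move: e2; rewrite e0 e5 => /addIr/addrI.
- by move: e4; rewrite e3 e5 => /addIr/addrI.
Qed.

(** Multiplied by [x ^+ 2], the discriminant becomes a polynomial in [a * x ^+ 2], [b * x] and
    [c * x] over the other coefficients. The two derivatives and the form itself express these
    through [y] and [z], without dividing by 2. *)
Lemma ternary_disc0 (R : comPzRingType) (a b c d e f x y z : R) :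
  a * x ^+ 2 + b * (x * y) + c * (x * z) + d * y ^+ 2 + e * (y * z) + f * z ^+ 2 = 0 ->
  b * x + 2%:R * d * y + e * z = 0 -> c * x + e * y + 2%:R * f * z = 0 ->
  x ^+ 2 * (4%:R * a * d * f + b * c * e - a * e ^+ 2 - d * c ^+ 2 - f * b ^+ 2) = 0.
Proof.
move=> q0 g1 g2.
have bx : b * x = - (2%:R * d * y + e * z).
  by rewrite -[LHS]subr0 -{1}g1; ring.
have cx : c * x = - (e * y + 2%:R * f * z).
  by rewrite -[LHS]subr0 -{1}g2; ring.
have axx : a * x ^+ 2 = d * y ^+ 2 + e * (y * z) + f * z ^+ 2.
  have -> : a * x ^+ 2 = 0 - (b * x) * y - (c * x) * z
    - (d * y ^+ 2 + e * (y * z) + f * z ^+ 2) by rewrite -q0; ring.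
  by rewrite bx cx; ring.
transitivity (a * x ^+ 2 * (4%:R * d * f - e ^+ 2) + (b * x) * (c * x) * e
   - d * (c * x) ^+ 2 - f * (b * x) ^+ 2); first by ring.
by rewrite axx bx cx; ring.
Qed.

Lemma sing_dsc a x : x != 0 -> sing a x -> dsc a = 0.
Proof.
rewrite rV3_eq0 /sing rV3_eq0 !row3E /fev /dsc => xn0.
move=> /andP[/eqP f0] /and3P[/eqP g0 /eqP g1 /eqP g2].
have D0 (t : F) : t ^+ 2 * dsc a = 0 -> t != 0 -> dsc a = 0.
  by move=> /eqP; rewrite mulf_eq0 expf_eq0 /= => /orP[->|/eqP].
case: (eqVneq (x 0 0) 0) xn0 => [x0 /=|x0 _]; last first.
  by apply: (D0 (x 0 0)) => //; apply: (ternary_disc0 f0 g1 g2).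
case: (eqVneq (x 0 1) 0) => [x1 /= x2|x1 _].
  (* The first and last variables are exchanged. *)
  apply: (D0 (x 0 2)) => //; rewrite /dsc.
  rewrite -[RHS](@ternary_disc0 _ (a 0 5) (a 0 4) (a 0 2) (a 0 3) (a 0 1) (a 0 0)
    (x 0 2) (x 0 1) (x 0 0)).
  - by ring.
  - by rewrite -[RHS]f0; ring.
  - by rewrite -[RHS]g1; ring.
  - by rewrite -[RHS]g0; ring.
(* The first two variables are exchanged. *)
apply: (D0 (x 0 1)) => //; rewrite /dsc.
rewrite -[RHS](@ternary_disc0 _ (a 0 3) (a 0 1) (a 0 4) (a 0 0) (a 0 2) (a 0 5)
    (x 0 1) (x 0 0) (x 0 2)).
- by ring.
- by rewrite -[RHS]f0; ring.
- by rewrite -[RHS]g0; ring.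
- by rewrite -[RHS]g2; ring.
Qed.

(** Squaring is additive in characteristic 2, hence injective, hence bijective on a finite field. *)
Lemma exists_sqrt_char2 (t : F) : 2%:R = 0 :> F -> exists s, t = s ^+ 2.
Proof.
move=> ch2; have sq_inj : injective (fun s : F => s ^+ 2).
  move=> s s' /= /eqP; rewrite -subr_eq0.
  have -> : s ^+ 2 - s' ^+ 2 = (s - s') ^+ 2 + 2%:R * (s * s' - s' ^+ 2) by ring.
  by rewrite ch2 mul0r addr0 expf_eq0 /= subr_eq0 => /eqP.
by have [g _ gK] := injF_bij sq_inj; exists (g t); rewrite gK.
Qed.

Lemma exists_orth l : exists2 x, x != 0 & dot l x = 0.
Proof.
have [l2|l2] := eqVneq (l 0 2) 0.
  exists (row3 0 0 1); first by rewrite rV3_eq0 !row3E oner_eq0 !andbF.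
  by rewrite dotE !row3E l2; ring.
exists (row3 0 (l 0 2) (- l 0 1)); first by rewrite rV3_eq0 !row3E (negPf l2) andbF.
by rewrite dotE !row3E; ring.
Qed.

(** The Gram matrix of the polar form. Here [symmx] only arranges the coefficients of [a] in a
    square. *)
Definition hess a : 'M[F]_3 :=
  \matrix_(i, j) (if i == j then 2%:R * symmx a i j else symmx a i j).

Lemma hess_grad a x : x *m hess a = grad a x.
Proof. by apply: rV3P; rewrite row3E mxE big_ord3 !mxE /=; ring. Qed.

Lemma det3 (M : 'M[F]_3) : \det M =
  M 0 0 * (M 1 1 * M 2 2 - M 1 2 * M 2 1) - M 0 1 * (M 1 0 * M 2 2 - M 1 2 * M 2 0)
  + M 0 2 * (M 1 0 * M 2 1 - M 1 1 * M 2 0).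
Proof.
rewrite (expand_det_row _ 0) big_ord3 /cofactor.
rewrite !(expand_det_row _ ord0) !big_ord_recr !big_ord0 /= /cofactor !det_mx11 !mxE /=.
pose f (i j : nat) := M (inZp i) (inZp j).
(* Indexing the entries by natural numbers lets the lifted ordinals of the cofactors be compared by
   computation. *)
have Mf i j : M i j = f i j by rewrite /f !valZpK.
by rewrite !Mf /= !modn_small //= /bump /=; ring.
Qed.

(* In odd characteristic 2 dsc a is the determinant of the Hessian.  In
   characteristic 2 the polar form is alternating with radical spanned by
   (a12, a02, a01), where the value of the form is dsc a; if this vector is 0 then
   the form is the square of a linear form. *)
Lemma dsc_sing a : dsc a = 0 -> exists2 x, x != 0 & sing a x.
Proof.
rewrite /dsc => D0; have [ch2|ch2] := eqVneq (2%:R : F) 0; last first.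
  have /eqP/det0P[x x0 xH] : \det (hess a) = 0.
    rewrite det3 !mxE /= -[RHS](mulr0 2%:R) -D0; ring.
  (* A kernel vector of the Hessian has gradient 0. Euler's identity and the invertibility of 2 then
     give the vanishing of the form. *)
  exists x => //; have gx : grad a x = 0 by rewrite -hess_grad.
  rewrite /sing gx eqxx andbT -(inj_eq (mulfI ch2)) mulr0.
  have -> : 2%:R * fev a x = dot (grad a x) x by rewrite /fev dotE !row3E; ring.
  by rewrite gx dotE !mxE; apply/eqP; ring.
have [r0|r0] := eqVneq (row3 (a 0 4) (a 0 2) (a 0 1)) 0; last first.
  exists (row3 (a 0 4) (a 0 2) (a 0 1)) => //; apply/andP; split; apply/eqP.
    rewrite /fev !row3E -[RHS]oppr0 -D0; apply/eqP; rewrite -subr_eq0.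
    apply/eqP.
    transitivity (2%:R * (2%:R * (a 0 0 * a 0 3 * a 0 5 + a 0 1 * a 0 2 * a 0 4))).
      by ring.
    by rewrite ch2; ring.
  apply: rV3P; rewrite !row3E mxE.
  - by transitivity (2%:R * (a 0 0 * a 0 4 + a 0 1 * a 0 2)); [ring|rewrite ch2 mul0r].
  - by transitivity (2%:R * (a 0 1 * a 0 4 + a 0 2 * a 0 3)); [ring|rewrite ch2 mul0r].
  - by transitivity (2%:R * (a 0 2 * a 0 4 + a 0 1 * a 0 5)); [ring|rewrite ch2 mul0r].
move: r0 => /eqP; rewrite rV3_eq0 !row3E => /and3P[/eqP a4 /eqP a2 /eqP a1].
have [s0 e0] := exists_sqrt_char2 (a 0 0) ch2.
have [s1 e1] := exists_sqrt_char2 (a 0 3) ch2.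
have [s2 e2] := exists_sqrt_char2 (a 0 5) ch2.
have [x x0 lx] := exists_orth (row3 s0 s1 s2).
exists x => //; apply/andP; split; apply/eqP.
  transitivity (dot (row3 s0 s1 s2) x ^+ 2 - 2%:R * (s0 * s1 * x 0 0 * x 0 1
    + s0 * s2 * x 0 0 * x 0 2 + s1 * s2 * x 0 1 * x 0 2)).
    by rewrite /fev dotE !row3E a1 a2 a4 e0 e1 e2; ring.
  by rewrite lx ch2; ring.
by apply: rV3P; rewrite row3E mxE ?a1 ?a2 ?a4 ch2; ring.
Qed.

(** The scalar is kept because it need not be a square in odd characteristic. The form 0 is
    included. *)
Definition issq a : bool :=
  [exists p : F * 'rV[F]_3, a == p.1 *: prodf p.2 p.2].

Lemma dotC u v : dot u v = dot v u.
Proof. by rewrite !dotE; ring. Qed.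

Lemma dotDZl u v w t : dot (t *: u + v) w = t * dot u w + dot v w.
Proof. by rewrite !dotE !mxE; ring. Qed.

Lemma fev_sq c l x : fev (c *: prodf l l) x = c * dot l x ^+ 2.
Proof. by rewrite fevZ fev_prodf expr2. Qed.

Lemma sing_sq c l x : c != 0 -> sing (c *: prodf l l) x = (dot l x == 0).
Proof.
move=> c0; rewrite /sing fev_sq gradZ grad_prodf mulf_eq0 (negPf c0) expf_eq0 /=.
by case: eqP => // ->; rewrite scale0r addr0 scaler0 eqxx.
Qed.

Lemma dsc_sq c l : dsc (c *: prodf l l) = 0.
Proof.
have E j : (c *: prodf l l) 0 j = c * prodf l l 0 j by rewrite mxE.
by rewrite /dsc !E !prodfE; ring.
Qed.

Lemma card_orth l : l != 0 -> #|[set x | dot l x == 0]| = (#|F| ^ 2)%N.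
Proof.
move=> l0; rewrite (_ : [set x | _] = [set x | x *m l^T == 0]).
  by rewrite card_row_kernel mxrank_tr rank_rV l0.
by apply/setP => x; rewrite !inE dotC mx11_eq0.
Qed.

(** The form is invariant under translation by the plane of [x1] and [x2], so it depends on a single
    coordinate transverse to that plane. *)
Lemma sing_issq a x1 x2 :
  sing a x1 -> sing a x2 -> \rank (col_mx x1 x2) = 2%N -> issq a.
Proof.
move=> s1 s2 rk; set G := row_ebase (col_mx x1 x2).
have Gu : G \in unitmx by apply: row_ebase_unit.
have sG (i : 'I_3) : (i < 2)%N -> sing a (row i G).
  move=> i2; have /row_ebase_sub/submxP[D] : (i < \rank (col_mx x1 x2))%N by rewrite rk.
  move=> ->.
  rewrite -[D]hsubmxK mul_row_col [lsubmx D]mx11_scalar [rsubmx D]mx11_scalar.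
  rewrite !mul_scalar_mx; apply: sing_arg_linear => //.
  by rewrite -[_ *: x2]addr0; apply: sing_arg_linear => //; apply: sing0.
pose l := (col 2 (invmx G))^T.
apply/existsP; exists (fev a (row 2 G), l); apply/eqP/fev_inj => v /=.
rewrite fev_sq -{1}[v](mulmxKV Gu) mulmx_sum_row big_ord3 -addrA.
rewrite !sing_arg ?sG // fevZr mulrC; congr (_ * _ ^+ 2).
by rewrite dotC /dot trmxK !mxE; apply: eq_bigr => i _; rewrite !mxE.
Qed.

(* The terms are distributed on both sides so that no subtraction occurs. *)
Lemma card_sing a : a != 0 ->
  (#|[set x | sing a x]| + (dsc a == 0%R) + issq a * #|F|
   = 1 + (dsc a == 0%R) * #|F| + issq a * #|F| ^ 2)%N.
Proof.
move=> a0; case: (boolP (issq a)) => [/existsP[[c l] /= /eqP Ea]|nsq].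
  have c0 : c != 0 by apply: contra_neq a0 => c0; rewrite Ea c0 scale0r.
  have l0 : l != 0.
    apply: contra_neq a0 => l0; rewrite Ea; apply: fev_inj => x.
    by rewrite fev_sq l0 dotE /fev !mxE; ring.
  rewrite Ea dsc_sq eqxx (_ : [set x | _] = [set x | dot l x == 0]).
    by rewrite card_orth //= !mul1n -addnA addnC.
  by apply/setP => x; rewrite !inE sing_sq.
rewrite !mul0n !addn0; case: eqP => [/dsc_sing[x1 x10 s1]|/eqP D0].
  rewrite mul1n addnC; congr (_ + _)%N.
  have -> : #|F| = #|[set x : 'rV[F]_3 | (x <= x1)%MS]|.
    by rewrite card_rowspace rank_rV x10.
  apply: eq_card => x; rewrite !inE.
  apply/idP/idP => [s2|/sub_rVP[t ->]]; last first.
    by rewrite -[_ *: x1]addr0; apply: sing_arg_linear => //; apply: sing0.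
  (* A singular vector off the line of [x1] would make the form a multiple of a square. *)
  apply: contraNT nsq => nx; apply: (sing_issq s1 s2).
  apply/eqP; rewrite eqn_leq rank_leq_row ltnNge; apply: contra nx => rk.
  have sx1 : (x1 <= col_mx x1 x)%MS by rewrite -addsmxE addsmxSl.
  apply: submx_trans (_ : (col_mx x1 x <= _)%MS); first by rewrite -addsmxE addsmxSr.
  by rewrite -(geq_leqif (mxrank_leqif_sup sx1)) rank_rV x10.
rewrite mul0n !addn0.
suff -> : [set x | sing a x] = [set 0] by rewrite cards1.
apply/setP => x; rewrite !inE; apply/idP/eqP => [s|->]; last exact: sing0.
by apply: contraNeq D0 => x0; rewrite (sing_dsc x0 s).
Qed.

(** The plane is given by its normal vector [p]. Two vectors vary independently because in
    characteristic 2 the vanishing of the quadratic form of [M] on the plane would be a weaker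
    condition. *)
Definition isotropic (M : 'M[F]_3) p : bool :=
  [forall u, forall v,
    [&& dot u p == 0 & dot v p == 0] ==> (u *m M *m v^T == 0)].

Lemma isotropicP (M : 'M[F]_3) p :
  reflect (forall u v, dot u p = 0 -> dot v p = 0 -> u *m M *m v^T = 0)
          (isotropic M p).
Proof.
apply: (iffP forallP) => [iM u v /eqP up /eqP vp|iM u].
  by apply/eqP; move: (iM u) => /forallP/(_ v); rewrite up vp.
by apply/forallP => v; apply/implyP => /andP[/eqP up /eqP vp]; apply/eqP/iM.
Qed.

Lemma bilE (M : 'M[F]_3) u v : (u *m M *m v^T) 0 0 =
  (u 0 0 * M 0 0 + u 0 1 * M 1 0 + u 0 2 * M 2 0) * v 0 0
  + (u 0 0 * M 0 1 + u 0 1 * M 1 1 + u 0 2 * M 2 1) * v 0 1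
  + (u 0 0 * M 0 2 + u 0 1 * M 1 2 + u 0 2 * M 2 2) * v 0 2.
Proof. by rewrite mxE big_ord3 !mxE !big_ord3. Qed.

(** This links both sides of the count: pairing a product of linear forms with a point of PG(5,q)
    evaluates the bilinear form of that point. *)
Lemma prodf_pairing u v y : prodf u v *m y^T = u *m symmx y *m v^T.
Proof.
apply/matrixP => i j; rewrite !ord1 bilE !symmxE mxE big_ord6 !prodfE.
by rewrite ![y^T _ _]mxE; ring.
Qed.

Lemma gradD a b x : grad (a + b) x = grad a x + grad b x.
Proof. by apply: rV3P; rewrite !(row3E, mxE) /=; ring. Qed.

Lemma sing_prodf_orth l m x : dot l x = 0 -> dot m x = 0 -> sing (prodf l m) x.
Proof.
by move=> lx mx; rewrite /sing fev_prodf grad_prodf lx mx mul0r !scale0r addr0 !eqxx.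
Qed.

Lemma sing_form_linear a b c x : sing a x -> sing b x -> sing (c *: a + b) x.
Proof.
move=> /andP[/eqP fa /eqP ga] /andP[/eqP fb /eqP gb].
by rewrite /sing fevD fevZ gradD gradZ fa fb ga gb mulr0 scaler0 !addr0 !eqxx.
Qed.

Lemma sing_formZ a c x : sing a x -> sing (c *: a) x.
Proof.
by move=> /andP[/eqP fa /eqP ga]; rewrite /sing fevZ gradZ fa ga mulr0 scaler0 !eqxx.
Qed.

Lemma dotDr u v w : dot u (v + w) = dot u v + dot u w.
Proof. by rewrite !dotE !mxE; ring. Qed.

Lemma dotZr u v t : dot u (t *: v) = t * dot u v.
Proof. by rewrite !dotE !mxE; ring. Qed.

(* With B a basis of the forms singular at x, the two sides count the left kernels
   of the 3 x 2 matrix B Y^T and of its transpose. *)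
Lemma card_sing_pencil (Y : 'M[F]_(2, 6)) x : x != 0 ->
  #|[set a | (a *m Y^T == 0) && sing a x]|
  = (#|F| * #|[set c : 'rV[F]_2 | isotropic (symmx (c *m Y)) x]|)%N.
Proof.
(* The rows of [g] form a basis starting with [x], and [b] is its dual basis, so [b 1] and [b 2]
   span the linear forms vanishing at [x]. *)
move=> /complete_row[g gu xg]; pose h := invmx g; pose b i := (col i h)^T.
have dotb i v : dot (b i) v = (v *m h) 0 i.
  by rewrite dotC /dot trmxK !mxE; apply: eq_bigr => j _; rewrite !mxE.
have vg v : v = dot (b 0) v *: x + (dot (b 1) v *: row 1 g + dot (b 2) v *: row 2 g).
  by rewrite -{1}[v](mulmxKV gu) mulmx_sum_row big_ord3 -addrA xg !dotb.
have dotbg i j : dot (b i) (row j g) = (i == j)%:R.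
  by rewrite dotb -row_mul mulmxV // !mxE eq_sym.
have b1x : dot (b 1) x = 0 by rewrite -xg dotbg.
have b2x : dot (b 2) x = 0 by rewrite -xg dotbg.
have ub u : dot u x = 0 -> u = dot u (row 1 g) *: b 1 + dot u (row 2 g) *: b 2.
  move=> ux; have e : g^T *m h^T = 1%:M by rewrite -trmx_mul mulVmx // trmx1.
  rewrite -{1}[u]mulmx1 -e mulmxA mulmx_sum_row big_ord3.
  have E i : (u *m g^T) 0 i = dot u (row i g).
    by rewrite /dot !mxE; apply: eq_bigr => j _; rewrite !mxE.
  by rewrite !E xg ux scale0r add0r /b !tr_col.
pose B := \matrix_(i < 3) nth 0 [:: prodf (b 1) (b 1); prodf (b 1) (b 2);
                                    prodf (b 2) (b 2)] i.
have uB (u : 'rV_3) : u *m B = u 0 0 *: prodf (b 1) (b 1)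
    + (u 0 1 *: prodf (b 1) (b 2) + u 0 2 *: prodf (b 2) (b 2)).
  by rewrite mulmx_sum_row big_ord3 !rowK -addrA.
have fevB (u : 'rV_3) v : fev (u *m B) v = u 0 0 * dot (b 1) v ^+ 2
    + u 0 1 * (dot (b 1) v * dot (b 2) v) + u 0 2 * dot (b 2) v ^+ 2.
  by rewrite uB !fevD !fevZ !fev_prodf; ring.
have B0 (u : 'rV_3) : u *m B = 0 -> u = 0.
  move=> u0; have e v : fev (u *m B) v = 0 by rewrite u0 /fev !mxE; ring.
  have e1 := e (row 1 g); have e2 := e (row 2 g); have e3 := e (row 1 g + row 2 g).
  move: e1 e2 e3; rewrite !fevB !dotDr !dotbg /=.
  rewrite !(expr0n, expr1n, mulr0, mul0r, mulr1, addr0, add0r) /=.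
  move=> u1 u3.
  rewrite u1 u3 add0r addr0 => u2.
  by apply: rV3P; rewrite mxE.
have singB a : sing a x = (a <= B)%MS.
  apply/idP/submxP => [sa|[u ->]]; last first.
    rewrite uB; apply: sing_form_linear; first exact: sing_prodf_orth.
    by apply: sing_form_linear; rewrite ?sing_formZ ?sing_prodf_orth.
  (* A form singular at [x] is determined by its restriction to the span of the other two basis
     vectors; these are the coefficients of that binary form. *)
  exists (row3 (fev a (row 1 g)) (dot (grad a (row 1 g)) (row 2 g)) (fev a (row 2 g))).
  apply: fev_inj => v; rewrite fevB !row3E {1}[v]vg sing_arg // fev_arg fevZr.
  by rewrite dotZr; ring.
have -> : #|[set a | (a *m Y^T == 0) && sing a x]|
          = #|[set u : 'rV_3 | u *m (B *m Y^T) == 0]|.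
  have injB : injective (fun u : 'rV_3 => u *m B).
    move=> u v /eqP; rewrite -subr_eq0 -mulmxBl => /eqP/B0/eqP.
    by rewrite subr_eq0 => /eqP.
  rewrite -(card_imset _ injB); apply: eq_card => a; rewrite !inE singB.
  apply/andP/imsetP => [[aY /submxP[u au]]|[u uY ->]].
    by exists u => //; rewrite inE mulmxA -au.
  by rewrite -mulmxA submxMl; split=> //; rewrite inE in uY.
have -> : #|[set c : 'rV_2 | isotropic (symmx (c *m Y)) x]|
          = #|[set c : 'rV_2 | c *m (B *m Y^T)^T == 0]|.
  apply: eq_card => c; rewrite !inE trmx_mul trmxK mulmxA.
  set y := c *m Y; rewrite -[y]trmxK -trmx_mul trmx_eq0 trmxK.
  apply/isotropicP/eqP => [iM|By u v ux vx].
    apply/row_matrixP; apply: forall_ord3;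
      by rewrite row_mul rowK row0 /= prodf_pairing iM.
  have : sing (prodf u v) x by apply: sing_prodf_orth.
  by rewrite singB -prodf_pairing => /submxP[w ->]; rewrite -mulmxA By mulmx0.
(* The kernels have dimensions 3 - r and 2 - r with r at most 2, which accounts for the factor
   [#|F|]. *)
rewrite !card_row_kernel mxrank_tr -expnS subSn //; exact: rank_leq_col.
Qed.
End Forms.

(** * Symmetric matrices and their totally isotropic planes *)

Section Conics.
Variable F : finFieldType.
Implicit Types (M g : 'M[F]_3) (l m u v x p : 'rV[F]_3).

Definition conic M : {set 'rV[F]_3} := [set x | x *m M *m x^T == 0].

(* A plane is represented by its normal vectors, so it is counted #|F| - 1 times. *)
Definition isolines M : {set 'rV[F]_3} :=
  [set p | (p != 0) && isotropic M p].

Lemma card_conic_congr M g : g \in unitmx ->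
  #|conic (g *m M *m g^T)| = #|conic M|.
Proof.
move=> gu; have injg : injective (fun x : 'rV[F]_3 => x *m g).
  exact: can_inj (mulmxK gu).
rewrite -(card_imset _ injg); apply: eq_card => x; rewrite [RHS]inE.
apply/imsetP/idP => [[z]|Mx].
  by rewrite inE => Mz ->; rewrite trmx_mul !mulmxA in Mz *.
exists (x *m invmx g); last by rewrite mulmxKV.
by rewrite inE !mulmxA mulmxKV // -!mulmxA -trmx_mul mulmxKV // mulmxA.
Qed.

(** The vector [p *m g^T] is normal to the preimage under [g] of the plane normal to [p]. *)
Lemma isotropic_congr M g p : g \in unitmx ->
  isotropic (g *m M *m g^T) (p *m g^T) = isotropic M p.
Proof.
move=> gu; have dotg u : dot u (p *m g^T) = dot (u *m g) p.
  by rewrite /dot trmx_mul trmxK mulmxA.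
apply/isotropicP/isotropicP => iM u v.
  move=> up vp; have := iM (u *m invmx g) (v *m invmx g).
  rewrite !dotg !mulmxKV // => /(_ up vp).
  by rewrite !mulmxA mulmxKV // -!mulmxA -trmx_mul mulmxKV // !mulmxA.
rewrite !dotg => up vp; have := iM _ _ up vp.
by rewrite trmx_mul !mulmxA.
Qed.

Lemma card_isolines_congr M g : g \in unitmx ->
  #|isolines (g *m M *m g^T)| = #|isolines M|.
Proof.
move=> gu; have gTu : g^T \in unitmx by rewrite unitmx_tr.
have injg : injective (fun x : 'rV[F]_3 => x *m g^T) by apply: can_inj (mulmxK gTu).
rewrite -(card_imset (isolines M) injg); apply: eq_card => p; rewrite [LHS]inE.
apply/andP/imsetP => [[p0 ip]|[z]].
  exists (p *m invmx g^T); last by rewrite mulmxKV.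
  rewrite inE -(isotropic_congr _ _ gu) mulmxKV // ip andbT.
  by apply: contra_neq p0 => z0; rewrite -[p](mulmxKV gTu) z0 mul0mx.
rewrite inE => /andP[z0 iz] ->; rewrite isotropic_congr //; split=> //.
by apply: contra_neq z0 => z0; rewrite -[z](mulmxK gTu) z0 mul0mx.
Qed.

Lemma sym3P M : M^T = M -> (M 1 0 = M 0 1) * (M 2 0 = M 0 2) * (M 2 1 = M 1 2).
Proof. by move=> MT; rewrite -{1 3 5}MT !mxE. Qed.

Lemma orth2P (s t a b : F) : (a != 0) || (b != 0) -> s * a + t * b = 0 ->
  exists c, s = c * b /\ t = - (c * a).
Proof.
move=> ab0 /eqP; rewrite addr_eq0 => /eqP e.
have [a0|a0] := eqVneq a 0.
  rewrite a0 eqxx /= in ab0; exists (s / b); rewrite divfK // a0 mulr0 oppr0.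
  split=> //; apply/eqP; rewrite -[_ == _]orbF -(negPf ab0) -mulf_eq0 -oppr_eq0 -e a0.
  by rewrite mulr0.
exists (- (t / a)); rewrite !mulNr divfK // opprK; split=> //.
by apply: (mulIf a0); rewrite e; field.
Qed.

(* Here the first basis vector e lies in the radical.  The cross product with e maps
   the conic onto the normal vectors of the isotropic planes, together with 0, and
   each fiber is a translate of the line of e. *)
Lemma card_conic_radical M : M^T = M -> M != 0 ->
  M 0 0 = 0 -> M 0 1 = 0 -> M 0 2 = 0 ->
  #|conic M| = (#|F| * #|isolines M|.+1)%N.
Proof.
move=> /sym3P MS M0 m00 m01 m02.
have bE u v : (u *m M *m v^T == 0) = (M 1 1 * (u 0 1 * v 0 1)
    + M 1 2 * (u 0 1 * v 0 2 + u 0 2 * v 0 1) + M 2 2 * (u 0 2 * v 0 2) == 0).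
  by rewrite mx11_eq0 bilE !MS m00 m01 m02; congr (_ == 0); ring.
pose J p := row3 0 (p 0 2) (- p 0 1).
have isoE p : p != 0 -> isotropic M p = (p 0 0 == 0) && (J p \in conic M).
  move=> p0; apply/isotropicP/idP => [iM|/andP[/eqP p00]].
    have [p00|p00] /= := eqVneq (p 0 0) 0.
      by rewrite inE iM // dotE !row3E p00; ring.
    (* If [p 0 0] is nonzero, the plane, with basis [u], [v], is a complement of the radical line,
       so its isotropy would force [M] to be 0. *)
    case/eqP: M0; pose u := row3 (- p 0 1) (p 0 0) 0.
    pose v := row3 (- p 0 2) 0 (p 0 0).
    have up : dot u p = 0 by rewrite dotE !row3E; ring.
    have vp : dot v p = 0 by rewrite dotE !row3E; ring.
    move: (iM u u up up) (iM u v up vp) (iM v v vp vp) => /eqP + /eqP + /eqP.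
    rewrite !bE !row3E !(mulr0, mul0r, addr0, add0r) !mulf_eq0 !(negPf p00) !orbF.
    move=> /eqP m11 /eqP m12 /eqP m22.
    by apply/matrixP; apply: forall_ord3; apply: forall_ord3;
      rewrite !mxE ?MS ?m00 ?m01 ?m02 ?m11 ?m12 ?m22.
  rewrite inE bE !row3E => /eqP Jp u v up vp.
  have {}p0 : (p 0 1 != 0) || (p 0 2 != 0).
    by move: p0; rewrite rV3_eq0 p00 eqxx /= negb_and.
  (* The plane normal to [p] is spanned by the radical vector and [J p], so modulo the radical its
     vectors are multiples of [J p]. *)
  have red w : dot w p = 0 -> exists c, w 0 1 = c * p 0 2 /\ w 0 2 = - (c * p 0 1).
    by rewrite dotE p00 mulr0 add0r => /(orth2P p0).
  have [[c [u1 u2]] [d [v1 v2]]] := (red _ up, red _ vp).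
  apply/eqP; rewrite bE u1 u2 v1 v2; apply/eqP.
  by rewrite -[RHS](mulr0 (c * d)) -Jp; ring.
pose f (w : F * 'rV[F]_3) := row3 w.1 (w.2 0 2) (- w.2 0 1).
pose P : {set 'rV[F]_3} := 0 |: isolines M.
have PE p : (p \in P) = (p 0 0 == 0) && (J p \in conic M).
  rewrite !inE; have [->|p0] /= := eqVneq p 0; last by rewrite isoE // inE.
  by rewrite bE !row3E !mxE oppr0 !(mulr0, addr0) !eqxx.
have cP : #|P| = #|isolines M|.+1 by rewrite cardsU1 !inE eqxx.
rewrite -cP -[in RHS]cardsT -cardsX -[RHS](card_in_imset (f := f)).
  apply: eq_card => x; apply/idP/imsetP => [Mx|[[s p] /=]].
    exists (x 0 0, row3 0 (- x 0 2) (x 0 1)); last first.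
      by apply: rV3P; rewrite /f !row3E ?opprK.
    rewrite in_setX in_setT PE !row3E eqxx /=.
    by move: Mx; rewrite /J !inE !bE !row3E opprK.
  rewrite in_setX in_setT PE => /andP[_ /andP[_ Jp]] ->.
  by move: Jp; rewrite /J /f /= !inE !bE !row3E.
move=> [s p] [t r]; rewrite !in_setX !PE /= => /andP[_ /andP[/eqP p0 _]].
move=> /andP[_ /andP[/eqP r0 _]] e.
have := (congr1 (fun m : 'rV[F]_3 => m 0 0) e, congr1 (fun m : 'rV[F]_3 => m 0 1) e,
         congr1 (fun m : 'rV[F]_3 => m 0 2) e).
rewrite /f !row3E /= => -[[-> e2] /oppr_inj e1].
by congr pair; apply: rV3P; rewrite ?p0 ?r0.
Qed.

Lemma sym_congr M g : M^T = M -> (g *m M *m g^T)^T = g *m M *m g^T.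
Proof. by move=> MT; rewrite !trmx_mul trmxK MT mulmxA. Qed.

Lemma congr_neq0 M g : g \in unitmx -> M != 0 -> g *m M *m g^T != 0.
Proof.
move=> gu; apply: contra_neq => e; have gTu : g^T \in unitmx by rewrite unitmx_tr.
by rewrite -[M](mulKmx gu) -[g *m M](mulmxK gTu) e mul0mx mulmx0.
Qed.

Lemma det_congr M g : \det (g *m M *m g^T) = \det g ^+ 2 * \det M.
Proof. by rewrite !det_mulmx det_tr; ring. Qed.

Lemma congr_00 M g : (g *m M *m g^T) 0 0 = (row 0 g *m M *m (row 0 g)^T) 0 0.
Proof. by rewrite -row_mul mxE [RHS]mxE; apply: eq_bigr => i _; rewrite !mxE. Qed.

(** A kernel vector of [M], taken as first basis vector, reduces this to the preceding radical case;
    both counts are invariant under congruence. *)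
Lemma card_conic_det0 M : M^T = M -> M != 0 -> \det M = 0 ->
  #|conic M| = (#|F| * #|isolines M|.+1)%N.
Proof.
move=> MT M0 /eqP/det0P[k /complete_row[g gu gk] kM].
have r0 i : (g *m M *m g^T) 0 i = 0.
  have : row 0 (g *m M *m g^T) = 0 by rewrite !row_mul gk kM mul0mx.
  by move/rowP/(_ i); rewrite !mxE.
rewrite -(card_conic_congr M gu) -(card_isolines_congr M gu).
apply: card_conic_radical => //; [exact: sym_congr | exact: congr_neq0].
Qed.

(** In a basis adapted to an isotropic plane, [M] has a zero block of size 2 in dimension 3, so its
    determinant vanishes. *)
Lemma isolines_det M : M^T = M -> \det M != 0 -> isolines M = set0.
Proof.
move=> MT D0; apply/eqP; rewrite -subset0; apply/subsetP => p; rewrite !inE.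
move=> /andP[/complete_row[h hu hp] ip]; apply: contraNT D0 => _.
(* This choice of [g] moves the normal vector [p] to the first unit vector. *)
pose g := (invmx h)^T; have gu : g \in unitmx by rewrite unitmx_tr unitmx_inv.
have /isotropicP : isotropic (g *m M *m g^T) (p *m g^T) by rewrite isotropic_congr.
have -> : p *m g^T = row3 1 0 0.
  rewrite trmxK -hp -row_mul mulmxV //.
  by apply: rV3P; rewrite row3E !mxE.
have /sym3P := sym_congr g MT.
have -> : (\det M == 0) = (\det (g *m M *m g^T) == 0).
  rewrite det_congr mulf_eq0 expf_eq0 /= (_ : \det g == 0 = false) //.
  by apply/negbTE; rewrite -unitfE.
move: (g *m M *m g^T) => N NS iN.
pose u := row3 0 1 0 : 'rV[F]_3; pose v := row3 0 0 1 : 'rV[F]_3.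
have ue : dot u (row3 1 0 0) = 0 by rewrite dotE !row3E; ring.
have ve : dot v (row3 1 0 0) = 0 by rewrite dotE !row3E; ring.
move: (iN u u ue ue) (iN u v ue ve) (iN v v ve ve) => /eqP + /eqP + /eqP.
rewrite !mx11_eq0 !bilE !row3E !(mulr0, mul0r, mul1r, mulr1, addr0, add0r).
by move=> /eqP n11 /eqP n12 /eqP n22; rewrite det3 !NS n11 n12 n22; apply/eqP; ring.
Qed.

(** A square has at most two roots, and 0 has only one, which makes the inequality strict. *)
Lemma card_squares : (#|F| < 2 * #|[set t ^+ 2 | t : F]|)%N.
Proof.
have s0 : 0 \in [set t ^+ 2 | t : F] by apply/imsetP; exists 0; rewrite // expr0n.
rewrite -[ltnLHS]sum1_card (partition_big_imset (fun t : F => t ^+ 2)) /=.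
rewrite -[X in (_ < 2 * X)%N]sum1_card big_distrr /=.
rewrite (bigD1 0) //= [ltnRHS](bigD1 0) //= muln1 -addSn.
apply: leq_add.
  rewrite sum1dep_card ltnS -(cards1 (0 : F)); apply/subset_leq_card/subsetP => t.
  by rewrite !inE expf_eq0.
apply: leq_sum => _ /andP[/imsetP[t _ ->] _]; rewrite sum1dep_card ?muln1.
have : (#|[set t; - t]| <= 2)%N by rewrite cards2; case: eqP.
apply: leq_trans; apply/subset_leq_card/subsetP => u.
by rewrite !inE eqf_sqr.
Qed.

(** The values of [a * x ^+ 2] and of [- d - y ^+ 2] each fill more than half of the field, so the
    two sets meet. *)
Lemma exists_diag_conic (a d : F) : a != 0 ->
  exists x y : F, a * x ^+ 2 + y ^+ 2 + d = 0.
Proof.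
move=> a0; pose S := [set t ^+ 2 | t : F].
pose S1 := [set a * s | s in S]; pose S2 := [set - d - s | s in S].
have c1 : #|S1| = #|S| by rewrite card_imset //; apply: mulfI.
have c2 : #|S2| = #|S| by rewrite card_imset // => s t /addrI/oppr_inj.
have : (0 < #|S1 :&: S2|)%N.
  rewrite -(ltn_add2l #|S1 :|: S2|) addn0 cardsUI c1 c2 addnn -mul2n.
  by apply: leq_ltn_trans card_squares; apply: max_card.
case/card_gt0P => z /setIP[/imsetP[_ /imsetP[x _ ->] ->] /imsetP[_ /imsetP[y _ ->] e]].
by exists x, y; rewrite e; ring.
Qed.

(* Completing squares turns x M x^T, up to a factor, into
   A X^2 + Y^2 + (A C - B^2) Z^2. *)
Lemma exists_conic_charn2 M : M^T = M -> 2%:R != 0 :> F ->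
  exists2 k, k != 0 & k \in conic M.
Proof.
move=> /sym3P MS ch2.
pose A := M 0 0 * M 1 1 - M 0 1 ^+ 2.
pose B := M 0 0 * M 1 2 - M 0 1 * M 0 2.
pose C := M 0 0 * M 2 2 - M 0 2 ^+ 2.
have [m0|m0] := eqVneq (M 0 0) 0.
  exists (row3 1 0 0); first by rewrite rV3_eq0 !row3E oner_eq0.
  by rewrite inE mx11_eq0 bilE !row3E m0; apply/eqP; ring.
have [A0|A0] := eqVneq A 0.
  (* This vector spans the kernel of the degenerate leading block of size 2. *)
  exists (row3 (- M 0 1) (M 0 0) 0); first by rewrite rV3_eq0 !row3E (negPf m0) andbF.
  rewrite inE mx11_eq0 bilE !row3E !MS; apply/eqP.
  by transitivity (M 0 0 * A); [rewrite /A; ring | rewrite A0 mulr0].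
have [X [Y XY]] : exists X Y, A * X ^+ 2 + Y ^+ 2 + (A * C - B ^+ 2) = 0.
  exact: exists_diag_conic.
(* These solve X = M00 x0 + M01 x1 + M02 and Y = A x1 + B, the completed squares at Z = 1. *)
pose x1 := (Y - B) / A; pose x0 := (X - M 0 1 * x1 - M 0 2) / M 0 0.
exists (row3 x0 x1 1); first by rewrite rV3_eq0 !row3E oner_eq0 !andbF.
rewrite inE mx11_eq0 bilE !row3E !MS.
suff -> : (x0 * M 0 0 + x1 * M 0 1 + 1 * M 0 2) * x0 +
   (x0 * M 0 1 + x1 * M 1 1 + 1 * M 1 2) * x1 +
   (x0 * M 0 2 + x1 * M 1 2 + 1 * M 2 2) * 1
  = (A * X ^+ 2 + Y ^+ 2 + (A * C - B ^+ 2)) / (M 0 0 * A) by rewrite XY mul0r.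
rewrite /x0 /x1 /B /C; move: A0; rewrite /A => A0; field.
by rewrite m0 A0.
Qed.

(** The mixed terms are doubled and vanish, so the conic is the square of a linear form. Were that
    form 0, [M] would be alternating of odd size, hence singular. *)
Lemma card_conic_char2 M : M^T = M -> \det M != 0 -> 2%:R = 0 :> F ->
  #|conic M| = (#|F| ^ 2)%N.
Proof.
move=> /sym3P MS D0 ch2.
have [s0 e0] := exists_sqrt_char2 (M 0 0) ch2.
have [s1 e1] := exists_sqrt_char2 (M 1 1) ch2.
have [s2 e2] := exists_sqrt_char2 (M 2 2) ch2.
rewrite -(@card_orth _ (row3 s0 s1 s2)).
  apply: eq_card => x; rewrite !inE mx11_eq0 -[RHS](expf_eq0 _ 2); congr (_ == 0).
  transitivity (dot (row3 s0 s1 s2) x ^+ 2 + 2%:R * ((M 0 1 - s0 * s1) * x 0 0 * x 0 1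
    + (M 0 2 - s0 * s2) * x 0 0 * x 0 2 + (M 1 2 - s1 * s2) * x 0 1 * x 0 2)).
    by rewrite bilE dotE !row3E !MS e0 e1 e2; ring.
  by rewrite ch2 mul0r addr0.
apply: contra_neq D0 => /eqP; rewrite rV3_eq0 !row3E => /and3P[/eqP z0 /eqP z1 /eqP z2].
rewrite det3 !MS e0 e1 e2 z0 z1 z2.
by transitivity (2%:R * (M 0 1 * M 0 2 * M 1 2)); [ring | rewrite ch2 mul0r].
Qed.

(* Here the first basis vector e is isotropic, with polar l.  A translate of the
   line of e off the plane l = 0 contains exactly one zero, and the plane
   contains only the multiples of e. *)
Lemma card_conic_charn2 M : M^T = M -> \det M != 0 -> 2%:R != 0 :> F ->
  M 0 0 = 0 -> #|conic M| = (#|F| ^ 2)%N.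
Proof.
move=> /sym3P MS D0 ch2 m0; pose l := row3 0 (M 0 1) (M 0 2).
have l0 : l != 0.
  apply: contra_neq D0 => /eqP; rewrite rV3_eq0 !row3E => /and3P[_ /eqP z1 /eqP z2].
  by rewrite det3 !MS m0 z1 z2; ring.
pose Q x := M 1 1 * x 0 1 ^+ 2 + 2%:R * M 1 2 * (x 0 1 * x 0 2) + M 2 2 * x 0 2 ^+ 2.
have QE x : (x \in conic M) = (2%:R * x 0 0 * dot l x + Q x == 0).
  by rewrite inE mx11_eq0 bilE /l dotE !row3E !MS m0; congr (_ == 0); rewrite /Q; ring.
pose Z := [set x | dot l x == 0].
have cZ : #|Z| = (#|F| ^ 2)%N by apply: card_orth.
have cZC : #|~: Z| = (#|F| * #|conic M :\: Z|)%N.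
  pose f (w : F * 'rV[F]_3) := w.1 *: row3 1 0 0 + w.2.
  have fE w : (f w 0 0 = w.1 + w.2 0 0) * (f w 0 1 = w.2 0 1) * (f w 0 2 = w.2 0 2).
    by rewrite /f !mxE /= mulr1 !mulr0 !add0r.
  have lf w : dot l (f w) = dot l w.2 by rewrite !dotE !fE !row3E; ring.
  have Qf w : Q (f w) = Q w.2 by rewrite /Q !fE.
  rewrite -[in RHS]cardsT -cardsX -[RHS](card_in_imset (f := f)).
    apply: eq_card => x; rewrite !inE; apply/idP/imsetP => [lx|[[t y]]].
      pose y := row3 (- Q x / (2%:R * dot l x)) (x 0 1) (x 0 2).
      exists (x 0 0 - y 0 0, y); last first.
        by apply: rV3P; rewrite fE /= ?subrK // /y !row3E.
      have ly : dot l y = dot l x by rewrite /y !dotE !row3E; ring.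
      rewrite in_setX in_setT in_setD [y \in Z]inE ly lx QE ly.
      have -> : Q y = Q x by rewrite /Q /y !row3E.
      by rewrite /y row3E; apply/eqP; field; rewrite lx ch2.
    rewrite in_setX in_setT in_setD [_ \in Z]inE.
    by move=> /andP[_ /andP[ly _]] ->; rewrite lf.
  move=> [s x] [t y]; rewrite !in_setX !in_setT !in_setD /= !QE ![_ \in Z]inE.
  move=> /andP[lx /eqP qx] /andP[ly /eqP qy] e.
  have elxy : dot l x = dot l y by rewrite -(lf (s, x)) e lf.
  have eQ : Q x = Q y by rewrite -(Qf (s, x)) e Qf.
  have e0 : s + x 0 0 = t + y 0 0 by have := (fE (s, x)).1.1; rewrite e fE.
  have e1 : x 0 1 = y 0 1 by have := (fE (s, x)).1.2; rewrite e fE.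
  have e2 : x 0 2 = y 0 2 by have := (fE (s, x)).2; rewrite e fE.
  have exy : x 0 0 = y 0 0.
    move: qx; rewrite -qy eQ elxy => /addIr/(mulIf ly)/(mulfI ch2) //.
  by move: e0; rewrite exy => /addIr ->; congr pair; apply: rV3P.
have cI : #|conic M :&: Z| = #|F|.
  rewrite -[RHS]cardsT -(card_imset setT (f := fun t => row3 t 0 0)); last first.
    by move=> s t /(congr1 (fun m : 'rV[F]_3 => m 0 0)); rewrite !row3E.
  apply: eq_card => x; rewrite in_setI QE inE; apply/andP/imsetP => [[/eqP qx /eqP lx]|].
    exists (x 0 0) => //; have /orth2P : x 0 1 * M 0 1 + x 0 2 * M 0 2 = 0.
      by move: lx; rewrite /l dotE !row3E mul0r add0r mulrC [M 0 2 * _]mulrC.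
    have nz : (M 0 1 != 0) || (M 0 2 != 0).
      by move: l0; rewrite rV3_eq0 !row3E eqxx -negb_and.
    (* On the plane [l = 0] one has [Q x = - c ^+ 2 * \det M], so a zero there must have [c = 0]. *)
    case/(_ nz) => c [x1 x2]; have /eqP : c ^+ 2 * \det M = 0.
      by rewrite -[RHS]oppr0 -qx lx /Q x1 x2 det3 !MS m0; ring.
    rewrite mulf_eq0 (negPf D0) orbF expf_eq0 /= => /eqP c0.
    by apply: rV3P; rewrite row3E ?x1 ?x2 ?c0 ?mul0r ?oppr0.
  by case=> t _ ->; rewrite /l /Q dotE !row3E; split; apply/eqP; ring.
have q0 : (0 < #|F|)%N by apply/card_gt0P; exists 0.
(* Off the plane there are (q^3 - q^2) / q zeros, and on it q, in total q^2. *)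
have := cardsID Z (conic M); rewrite cI => <-.
apply/eqP; rewrite -(eqn_pmul2l q0) mulnDr -cZC -cZ.
rewrite -(eqn_add2l #|Z|) addnCA cardsC card_mx mul1n cZ; apply/eqP.
by rewrite -!expnS addnC.
Qed.

Lemma card_conic_det M : M^T = M -> \det M != 0 -> #|conic M| = (#|F| ^ 2)%N.
Proof.
move=> MT D0; have [ch2|ch2] := eqVneq (2%:R : F) 0; first exact: card_conic_char2.
have [k /complete_row[g gu gk]] := exists_conic_charn2 MT ch2.
rewrite inE mx11_eq0 -gk => /eqP kM; rewrite -(card_conic_congr M gu).
apply: card_conic_charn2 => //; [exact: sym_congr | | by rewrite congr_00].
by rewrite det_congr mulf_neq0 // expf_neq0 // -unitfE.
Qed.

(** Both cases are merged into one equation free of subtraction, ready to be summed over the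
    pencil. *)
Lemma card_conic M : M^T = M -> M != 0 ->
  (#|conic M| + (\det M == 0%R) * #|F| ^ 2
   = #|F| ^ 2 + (\det M == 0%R) * #|F| + #|F| * #|isolines M|)%N.
Proof.
move=> MT M0; case: eqP => [D0|/eqP D0].
  by rewrite card_conic_det0 // !mul1n mulnS addnC addnA.
by rewrite card_conic_det // isolines_det // cards0 !mul0n muln0 !addn0.
Qed.
End Conics.

(** * Double counting over a web and a pencil *)

Section Counting.
Variable F : finFieldType.
Local Notation q := #|F|.

Lemma card_units : #|[set t : F | t != 0]| = q.-1.
Proof. by rewrite -(cardC1 (0 : F)); apply: eq_card => t; rewrite !inE. Qed.

Lemma card_fibers (T U : finType) (f : T -> U) (A : {set T}) (k : nat) :
  {in A, forall x, #|[set z in A | f z == f x]| = k} -> #|A| = (k * #|f @: A|)%N.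
Proof.
move=> fk; rewrite -sum1_card (partition_big_imset f) /=.
rewrite mulnC -sum_nat_const; apply: eq_bigr => _ /imsetP[x xA ->].
by rewrite -[RHS](fk x xA) -sum1_card; apply: eq_bigl => z; rewrite inE.
Qed.

Lemma card_setE (T : finType) (P Q : pred T) :
  #|[set x | P x && Q x]| = (\sum_(x | P x) Q x)%N.
Proof.
by rewrite -sum1dep_card big_mkcondr /=; apply: eq_bigr => x _; case: (Q x).
Qed.

Lemma card_setE3 (T : finType) (P Q R : pred T) :
  #|[set x | P x & Q x && R x]| = (\sum_(x | P x && Q x) R x)%N.
Proof. by rewrite -card_setE; apply: eq_card => x; rewrite !inE andbA. Qed.

Lemma cards_exchange (T U : finType) (P : pred T) (Q : pred U) (r : T -> U -> bool) :
  (\sum_(x | P x) #|[set y | Q y && r x y]|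
   = \sum_(y | Q y) #|[set x | P x && r x y]|)%N.
Proof.
under eq_bigr do rewrite card_setE.
by rewrite exchange_big; apply: eq_bigr => y _; rewrite card_setE.
Qed.

(** The two squares have the same zeros, so [l] and [l0] are proportional; the scalars are compared
    where [l0] takes the value 1. *)
Lemma prodf_eq_line (c c0 : F) (l l0 : 'rV[F]_3) : c != 0 -> l != 0 ->
  c *: prodf l l = c0 *: prodf l0 l0 -> l0 != 0 ->
  exists2 t, t != 0 & l = t *: l0 /\ c = c0 / t ^+ 2.
Proof.
move=> cn0 ln0 e l0n0.
have /sub_rVP[t lt] : (l <= l0)%MS.
  (* The columns of [cokermx l0] are zeros of [l0], so [l] must vanish on each of them. *)
  rewrite submxE; apply/eqP; apply: trmx_inj; rewrite trmx0.
  apply/row_matrixP => j; rewrite row0 -tr_col; apply/eqP; rewrite trmx_eq0.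
  rewrite colE -mulmxA -colE mx11_eq0.
  have d0 : dot l0 (col j (cokermx l0))^T = 0.
    by rewrite /dot trmxK colE mulmxA mulmx_coker mul0mx mxE.
  have : c * dot l (col j (cokermx l0))^T ^+ 2 = 0.
    by rewrite -fev_sq e fev_sq d0 expr0n mulr0.
  by move/eqP; rewrite mulf_eq0 (negPf cn0) expf_eq0 /= /dot trmxK.
have t0 : t != 0 by apply: contra_neq ln0 => t0; rewrite lt t0 scale0r.
exists t => //; split=> //; apply: (mulIf (expf_neq0 2 t0)); rewrite divfK ?expf_neq0 //.
have [g gu g0] := complete_row l0n0; pose w := (col 0 (invmx g))^T.
have dw : dot l0 w = 1.
  by rewrite /dot trmxK -g0 colE mulmxA -row_mul mulmxV // -colE !mxE eqxx.
have := congr1 (fun a => fev a w) e.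
rewrite /= !fev_sq lt -[t *: l0]addr0 dotDZl dw.
by rewrite !dotE !mxE !mul0r !addr0 mulr1 expr1n mulr1.
Qed.

Lemma prodf00 : prodf 0 0 = 0 :> 'rV[F]_6.
Proof. by apply: fev_inj => x; rewrite fev_prodf !dotE /fev !mxE; ring. Qed.

Lemma prodf_sq_neq0 (l : 'rV[F]_3) : l != 0 -> prodf l l != 0.
Proof.
apply: contra_neq => e; have E j := congr1 (fun a : 'rV[F]_6 => a 0 j) e.
apply: rV3P; rewrite mxE; apply/eqP; rewrite -[_ == _]orbb -mulf_eq0; apply/eqP.
- by have := E 0; rewrite prodfE mxE.
- by have := E 3; rewrite prodfE mxE.
- by have := E 5; rewrite prodfE mxE.
Qed.

(** The rows of [Y] stand for a basis of the line; [W] is then its web in coordinates, and the [M c]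
    are the matrices of the vectors of the line. *)
Variable Y : 'M[F]_(2, 6).
Hypothesis Yfree : row_free Y.
Local Notation W := [pred a : 'rV[F]_6 | a *m Y^T == 0].
Local Notation M c := (symmx (c *m Y)).

Lemma card_web : #|[set a | W a]| = (q ^ 4)%N.
Proof. by rewrite card_row_kernel mxrank_tr (eqP Yfree). Qed.

Lemma q_gt1 : (1 < q)%N.
Proof. exact: card_finNzRing_gt1. Qed.

(** A nonzero multiple [c *: prodf l l] of a square is represented exactly by the pairs
    [(c / t ^+ 2, t *: l)]. Their number q - 1 is also the number of choices of [c], so the two
    factors cancel; the successor accounts for [l = 0]. *)
Lemma card_web_squares :
  #|[set l : 'rV[F]_3 | W (prodf l l)]| = #|[set a | W a & (a != 0) && issq a]|.+1.
Proof.
set B := [set l : 'rV[F]_3 | _]; set R := [set a : 'rV[F]_6 | _].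
have B0 : 0 \in B.
  by rewrite inE /= prodf00 mul0mx.
rewrite (cardsD1 0) B0 add1n; congr _.+1.
pose P := setX [set t : F | t != 0] (B :\ 0).
pose f (p : F * 'rV[F]_3) := p.1 *: prodf p.2 p.2.
have q1 : (0 < q.-1)%N by have := q_gt1; case: q.
have fP : f @: P = R.
  apply/setP => a; rewrite inE.
  apply/imsetP/and3P => [[[c l]]|[Wa a0 /existsP[[c l] /= /eqP al]]].
    rewrite in_setX !inE /= => /and3P[c0 l0 Wl] ->; split.
    - by rewrite -scalemxAl (eqP Wl) scaler0.
    - by rewrite scaler_eq0 negb_or c0 prodf_sq_neq0.
    - by apply/existsP; exists (c, l).
  have [c0 l0] : c != 0 /\ prodf l l != 0.
    by apply/andP; rewrite -negb_or -scaler_eq0 -al.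
  exists (c, l); last by rewrite al.
  rewrite in_setX !inE /= c0 [true && _]/=; apply/andP; split.
    by apply: contra_neq l0 => ->; apply: prodf00.
  move: Wa; rewrite /= al -scalemxAl scaler_eq0 (negPf c0) //.
apply/eqP; rewrite -(eqn_pmul2l q1) -card_units -cardsX -fP -/P.
apply/eqP/card_fibers => -[c l]; rewrite in_setX !inE /= => /and3P[c0 l0 Wl].
pose h t := (c / t ^+ 2, t *: l).
have hinj : injective h.
  move=> s t [_ /eqP]; rewrite -subr_eq0 -scalerBl scaler_eq0 (negPf l0) orbF.
  by rewrite subr_eq0 => /eqP.
rewrite -(card_imset _ hinj); apply: eq_card => -[d m]; rewrite inE in_setX !inE /=.
apply/andP/imsetP => [[/and3P[d0 m0 Wm] /eqP e]|[t]].
  have [t t0 [mt dt]] := prodf_eq_line d0 m0 e l0.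
  by exists t; rewrite ?inE // /h mt dt.
rewrite inE => t0 [-> ->]; have pt : prodf (t *: l) (t *: l) = t ^+ 2 *: prodf l l.
  by apply: fev_inj => x; rewrite fevZ !fev_prodf -[t *: l]addr0 dotDZl !dotE !mxE; ring.
rewrite /f /= pt scalerA divfK ?expf_neq0 // eqxx; split=> //.
rewrite mulf_neq0 ?invr_eq0 ?expf_neq0 // scaler_eq0 negb_or t0 l0.
by rewrite -scalemxAl (eqP Wl) scaler0 eqxx.
Qed.

Lemma cards_split0 (V : finZmodType) (P : pred V) (f : V -> nat) : P 0%R ->
  (\sum_(x | P x) f x = f 0%R + \sum_(x | P x && (x != 0%R)) f x)%N.
Proof. by move=> P0; rewrite (bigD1 0). Qed.

Lemma symmx_eq0 (y : 'rV[F]_6) : symmx y = 0 -> y = 0.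
Proof.
move=> e; have E i j := congr1 (fun N : 'M[F]_3 => N i j) e.
apply/rowP; apply: forall_ord6; rewrite mxE.
- by have := E 0 0; rewrite symmxE mxE.
- by have := E 0 1; rewrite symmxE mxE.
- by have := E 0 2; rewrite symmxE mxE.
- by have := E 1 1; rewrite symmxE mxE.
- by have := E 1 2; rewrite symmxE mxE.
- by have := E 2 2; rewrite symmxE mxE.
Qed.

Lemma tr_symmx (y : 'rV[F]_6) : (symmx y)^T = symmx y.
Proof.
by apply/matrixP; apply: forall_ord3; apply: forall_ord3; rewrite mxE !symmxE.
Qed.

Lemma symmx0 : symmx (0 : 'rV[F]_6) = 0.
Proof. by apply/matrixP => i j; rewrite !mxE. Qed.

Lemma sing_form0 (x : 'rV[F]_3) : sing 0 x.
Proof.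
have -> : 0 = 0 *: prodf x x by rewrite scale0r.
by rewrite /sing fevZ gradZ mul0r scale0r !eqxx.
Qed.

(** The value at [x] is linear in [c], so its kernel is a line unless it is 0, which happens when
    the square of the linear form [x] is in the web. *)
Lemma card_pencil_zero (x : 'rV[F]_3) :
  (#|[set c : 'rV[F]_2 | x \in conic (M c)]| + q * W (prodf x x)
   = q + q ^ 2 * W (prodf x x))%N.
Proof.
rewrite (_ : [set c | _] = [set c : 'rV_2 | c *m (Y *m (prodf x x)^T) == 0]); last first.
  by apply/setP => c; rewrite !inE -prodf_pairing -trmx_eq0 trmx_mul trmxK mulmxA.
have -> : W (prodf x x) = (Y *m (prodf x x)^T == 0).
  by rewrite /= -trmx_eq0 trmx_mul trmxK.
rewrite card_row_kernel -mxrank_tr rank_rV trmx_eq0.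
by case: eqP => _; rewrite ?muln1 ?muln0 ?addn0 // addnC.
Qed.

(** In the double count, q^3 comes from the form 0 and q^4 from the vector 0. The term in
    [(q ^ 3).-1] comes from [c = 0], for which every plane is isotropic. *)
Lemma sum_card_sing :
  let T := (\sum_(c : 'rV[F]_2 | c != 0%R) #|isolines (M c)|)%N in
  (\sum_(a | W a && (a != 0%R)) #|[set x | sing a x]| + q ^ 3
   = q ^ 4 + q * (q ^ 3).-1 + q * T)%N.
Proof.
move=> T.
have := @cards_exchange _ _ W predT (fun a x => sing a x).
rewrite /= (cards_split0 (P := W)) ?[RHS](cards_split0 (P := predT)) //=; last first.
  by rewrite mul0mx.
rewrite (_ : [set x : 'rV[F]_3 | _] = setT); last first.
  by apply/setP => x; rewrite !inE sing_form0.
rewrite cardsT card_mx mul1n addnC => ->.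
rewrite (_ : [set x : 'rV[F]_6 | _ ] = [set a | W a]); last first.
  by apply/setP => a; rewrite !inE sing0 andbT.
rewrite card_web -addnA; congr addn.
under eq_bigr => x x0 do rewrite card_sing_pencil //.
rewrite -big_distrr -mulnDr /=; congr muln.
have := @cards_exchange _ _ [pred x : 'rV[F]_3 | x != 0] predT
  (fun x (c : 'rV[F]_2) => isotropic (M c) x).
rewrite /= [RHS](cards_split0 (P := predT)) //= => ->; congr addn.
have <- : #|[set x : 'rV[F]_3 | x != 0]| = (q ^ 3).-1.
  rewrite -[(q ^ 3)%N](card_mx F 1 3) -(cardC1 (0 : 'rV[F]_3)).
  by apply: eq_card => x; rewrite !inE.
apply: eq_card => x; rewrite !inE andb_idr // => _.
apply/isotropicP => u v _ _; rewrite mul0mx.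
by rewrite symmx0 mulmx0 mul0mx.
Qed.

(** The pairs of a parameter [c] and a zero of [M c] are counted in two ways, with
    [card_pencil_zero] for each zero; q^3 is the contribution of [c = 0]. *)
Lemma sum_card_conic :
  let B := #|[set l : 'rV[F]_3 | W (prodf l l)]| in
  (\sum_(c : 'rV[F]_2 | c != 0%R) #|conic (M c)| + q ^ 3 + q * B
   = q ^ 4 + q ^ 2 * B)%N.
Proof.
move=> B; have := @cards_exchange _ _ predT predT
  (fun (c : 'rV[F]_2) x => x \in conic (M c)).
rewrite /= (cards_split0 (P := predT)) //=.
have -> : #|[set x | x \in conic (M 0)]| = (q ^ 3)%N.
  rewrite -[(q ^ 3)%N](card_mx F 1 3) -cardsT; apply: eq_card => x.
  by rewrite !inE mul0mx symmx0 mulmx0 mul0mx eqxx.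
rewrite [(q ^ 3 + _)%N]addnC => e.
under eq_bigr do rewrite -cardsE.
rewrite {}e.
have -> : B = (\sum_(l : 'rV[F]_3) W (prodf l l))%N.
  by rewrite /B -sum1dep_card big_mkcond /=; apply: eq_bigr => l _; case: (_ == _).
have -> : (q ^ 4 = \sum_(l : 'rV[F]_3) q)%N.
  by rewrite sum_nat_const (card_mx F 1 3) -expnSr.
by rewrite !big_distrr -!big_split; apply: eq_bigr => l _; apply: card_pencil_zero.
Qed.

Lemma card_discriminant :
  (#|[set a | W a & (a != 0%R) && (dsc a == 0%R)]|
   = q.-1 * (q ^ 2 + 1)
     + q * #|[set c : 'rV[F]_2 | (c != 0%R) && (\det (M c) == 0%R)]|)%N.
Proof.
have e1 := sum_card_sing; have e2 := sum_card_conic; have e3 := card_web_squares.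
have e4 : (\sum_(a | W a && (a != 0%R)) #|[set x | sing a x]|
   + #|[set a | W a & (a != 0%R) && (dsc a == 0%R)]|
   + q * #|[set a | W a & (a != 0%R) && issq a]|
  = (q ^ 4).-1 + q * #|[set a | W a & (a != 0%R) && (dsc a == 0%R)]|
   + q ^ 2 * #|[set a | W a & (a != 0%R) && issq a]|)%N.
  rewrite !card_setE3 !big_distrr /= -!big_split /=.
  have -> : (q ^ 4).-1 = (\sum_(a | W a && (a != 0%R)) 1)%N.
    by rewrite sum1_card -card_web [in LHS](cardsD1 0) inE /= mul0mx eqxx;
      apply: eq_card => a; rewrite !inE andbC.
  rewrite -!big_split /=; apply: eq_bigr => a /andP[_ a0].
  by rewrite [(q * _)%N]mulnC card_sing // mulnC [(q ^ 2 * _)%N]mulnC.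
have e5 : (\sum_(c : 'rV[F]_2 | c != 0%R) #|conic (M c)|
   + q ^ 2 * #|[set c : 'rV[F]_2 | (c != 0%R) && (\det (M c) == 0%R)]|
   = (q ^ 2).-1 * q ^ 2
   + q * #|[set c : 'rV[F]_2 | (c != 0%R) && (\det (M c) == 0%R)]|
   + q * \sum_(c : 'rV[F]_2 | c != 0%R) #|isolines (M c)|)%N.
  rewrite !card_setE !big_distrr /= -!big_split /=.
  have -> : ((q ^ 2).-1 * q ^ 2 = \sum_(c : 'rV[F]_2 | c != 0%R) q ^ 2)%N.
    rewrite sum_nat_const; congr muln.
    rewrite -[(q ^ 2)%N](card_mx F 1 2) -(cardC1 (0 : 'rV[F]_2)).
    by apply: eq_card => x; rewrite !inE.
  rewrite -!big_split /=; apply: eq_bigr => c c0.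
  rewrite mulnC card_conic ?tr_symmx //; last first.
    apply: contra_neq c0 => /symmx_eq0/eqP.
    by rewrite mulmx_free_eq0 // => /eqP.
  by rewrite [(q * nat_of_bool _)%N]mulnC.
move: e1 e2 e3 e4 e5 q_gt1 => /=.
move: (\sum_(a | _) _)%N (\sum_(c | _) #|conic _|)%N (\sum_(c | _) #|isolines _|)%N.
move: #|[set c : 'rV[F]_2 | _]|.
move: #|[set a : 'rV[F]_6 | _ & _ && issq a]|.
move: #|[set a : 'rV[F]_6 | _ & _ && (dsc a == _)]| => Nd R D S Z T.
move: #|[set l : 'rV[F]_3 | _]| => B.
case: #|F| => [//|m] e1 e2 e3 e4 e5 q1.
(* With q = m + 1, the relations determine q - 1 times the required number. Once the predecessors of
   powers are expanded, a linear combination of the relations suffices. *)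
apply/eqP; rewrite -(eqn_pmul2l (_ : 0 < m)%N) //; apply/eqP.
have pK k : ((m.+1 ^ k).-1 + 1 = m.+1 ^ k)%N by rewrite addn1 prednK // expn_gt0.
move: e1 e2 e4 e5 (pK 2) (pK 3) (pK 4); rewrite {}e3.
move: (m.+1 ^ 2).-1 (m.+1 ^ 3).-1 (m.+1 ^ 4).-1 => p2 p3 p4.
rewrite !expnS !expn0 /= => e1 e2 e4 e5 h2 h3 h4.
have {h2}E2 : p2 = (m * m + 2 * m)%N by lia.
have {h3}E3 : p3 = (m * m * m + 3 * m * m + 3 * m)%N by lia.
have {h4}E4 : p4 = (m * m * m * m + 4 * m * m * m + 6 * m * m + 4 * m)%N by lia.
rewrite {}E2 in e5; rewrite {}E3 in e1; rewrite {}E4 in e4.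
lia.
Qed.
End Counting.

(** * Passage to projective space *)

Section Projective.
Variable F : finFieldType.
Local Notation q := #|F|.

Lemma ppoint_eqP n (v w : 'rV[F]_n.+1) : v != 0 -> w != 0 ->
  reflect (exists2 a, a != 0 & w = a *: v) (ppoint w == ppoint v).
Proof.
move=> v0 w0; apply: (iffP eqP) => [e|[a a0 ->]].
  have : w \in ppoint v by rewrite -e; apply/imsetP; exists 1; rewrite ?scale1r.
  case/imsetP => a _ wa; exists a => //.
  by apply: contra_neq w0 => a0; rewrite wa a0 scale0r.
apply/setP => x; apply/imsetP/imsetP => -[b _ ->].
  by exists (b * a); rewrite ?scalerA.
by exists (b / a); rewrite // scalerA divfK.
Qed.

(** Each point is the class of q - 1 nonzero vectors, all satisfying [P] as soon as one does. *)
Lemma card_ppoints n (P : pred 'rV[F]_n.+1) :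
  (forall a v, a != 0 -> P v -> P (a *: v)) ->
  #|[set v | (v != 0) && P v]|
  = (q.-1 * #|[set ppoint v | v : 'rV[F]_n.+1 & (v != 0%R) && P v]|)%N.
Proof.
move=> PZ; pose A := [set v | (v != 0) && P v].
have -> : [set ppoint v | v : 'rV[F]_n.+1 & (v != 0) && P v] = @ppoint F n @: A.
  apply/setP => p; apply/imsetP/imsetP => -[v Av ->]; exists v;
    by rewrite ?inE // in Av *.
apply: card_fibers => v; rewrite inE => /andP[v0 Pv].
have injv : injective (fun a => a *: v).
  move=> s t /eqP; rewrite -subr_eq0 -scalerBl scaler_eq0 (negPf v0) orbF.
  by rewrite subr_eq0 => /eqP.
rewrite -card_units -(card_imset _ injv); apply: eq_card => w; rewrite !inE.
apply/andP/imsetP => [[/andP[w0 Pw]]|[a]].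
  by case/(ppoint_eqP v0 w0) => a a0 ->; exists a; rewrite ?inE.
rewrite inE => a0 ->; have av0 : a *: v != 0 by rewrite scaler_eq0 negb_or a0.
by rewrite av0 PZ //; split=> //; apply/ppoint_eqP => //; exists a.
Qed.

Lemma rank_le2 (A : 'M[F]_3) : (\rank A <= 2)%N = (\det A == 0).
Proof.
rewrite -[RHS]negbK -unitfE -unitmxE -row_free_unit.
by rewrite -ltnS ltn_neqAle rank_leq_row andbT.
Qed.

Lemma ppoints_secant (L : {vspace 'rV[F]_6}) :
  ppoints L :&: secant_variety F
  = [set ppoint y | y : 'rV[F]_6 & (y != 0) && ((y \in L) && (\det (symmx y) == 0))].
Proof.
apply/setP => p; apply/setIP/imsetP => [[/imsetP[y]]|[y]]; rewrite ?inE.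
  move=> /andP[y0 yL] -> /imsetP[z]; rewrite inE rank_le2 => /andP[z0 Dz] /eqP.
  move=> /(ppoint_eqP z0 y0)[a a0 ya]; exists y => //; rewrite inE y0 yL ya.
  have -> : symmx (a *: z) = a *: symmx z by apply/matrixP => i j; rewrite !mxE.
  by rewrite detZ mulf_eq0 Dz orbT.
by move=> /and3P[y0 yL Dy] ->; split; apply/imsetP; exists y; rewrite // inE y0 ?rank_le2.
Qed.

End Projective.

(** * The web and the cubic surface in coordinates *)

Section Web.
Variable F : finFieldType.
Local Notation q := #|F|.

Definition coefs (R : nzRingType) (f : {mpoly R[3]}) : 'rV[R]_6 :=
  \row_j nth 0 [:: qcoef f 0 0; qcoef f 0 1; qcoef f 0 2;
                   qcoef f 1 1; qcoef f 1 2; qcoef f 2 2] j.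

Lemma coefsE (R : nzRingType) (f : {mpoly R[3]}) :
  (coefs f 0 0 = qcoef f 0 0) * (coefs f 0 1 = qcoef f 0 1)
  * (coefs f 0 2 = qcoef f 0 2) * (coefs f 0 3 = qcoef f 1 1)
  * (coefs f 0 4 = qcoef f 1 2) * (coefs f 0 5 = qcoef f 2 2).
Proof. by rewrite !mxE. Qed.

Lemma hypeval_coefs (f : {mpoly F[3]}) y : hypeval f y = (coefs f *m y^T) 0 0.
Proof. by rewrite mxE big_ord6 !coefsE ![y^T _ _]mxE. Qed.

Lemma coefs_linear a (f g : {mpoly F[3]}) : coefs (a *: f + g) = a *: coefs f + coefs g.
Proof.
have E k (u v : 'rV[F]_6) : (a *: u + v) 0 k = a * u 0 k + v 0 k by rewrite !mxE.
by apply/rowP; apply: forall_ord6; rewrite E !coefsE /qcoef mcoeffD mcoeffZ.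
Qed.

Lemma coefs_sum n (v : 'rV[F]_n) (fs : n.-tuple (qform F)) :
  coefs (\sum_i v 0 i *: tnth fs i : qform F) = v *m \matrix_i coefs (tnth fs i).
Proof.
rewrite mulmx_sum_row; under [RHS]eq_bigr do rewrite rowK.
elim/big_rec2: _ => [|i f a _ <-]; last by rewrite -coefs_linear linearP.
by apply/rowP; apply: forall_ord6; rewrite coefsE /qcoef mcoeff0 mxE.
Qed.

Lemma dscZ (c : F) a : dsc (c *: a) = c ^+ 3 * dsc a.
Proof.
have E j : (c *: a) 0 j = c * a 0 j by rewrite mxE.
by rewrite /dsc !E; ring.
Qed.

Lemma mdeg2P (m : 'X_{1..3}) : mdeg m = 2%N -> exists i j, m = (U_(i) + U_(j))%MM.
Proof.
move=> m2; have [i mi] : exists i, m i != 0%N.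
  apply/existsP; rewrite -[X in is_true X]negbK negb_exists; apply: contra_eqN m2.
  move=> /forallP m0; rewrite mdegE big1 // => i _.
  by have := m0 i; rewrite negbK => /eqP.
have Em := submK (m := U_(i)%MM) (m' := m); rewrite lep1mP mi in Em.
have /mdeg1P[j /eqP Ej] : mdeg (m - U_(i))%MM == 1%N.
  by have := mdegD (m - U_(i))%MM U_(i)%MM; rewrite Em // m2 mdeg1 addn1 => -[<-].
by exists j, i; rewrite -Ej Em.
Qed.

Lemma coefs_inj (f g : qform F) : coefs f = coefs g -> f = g.
Proof.
move=> e; apply/val_inj/mpolyP => m /=.
have [/mdeg2P[i [j ->]]|m2] := eqVneq (mdeg m) 2%N; last first.
  by rewrite !(dhomog_nemf_coeff (valP _)).
have E k : coefs f 0 k = coefs g 0 k by rewrite e.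
have qC (h : {mpoly F[3]}) k l : qcoef h k l = qcoef h l k by rewrite /qcoef addmC.
suff : qcoef f i j = qcoef g i j by [].
move: i j; apply: forall_ord3; apply: forall_ord3.
- by have := E 0; rewrite !coefsE.
- by have := E 1; rewrite !coefsE.
- by have := E 2; rewrite !coefsE.
- by have := E 1; rewrite !coefsE 2!(qC _ 1).
- by have := E 3; rewrite !coefsE.
- by have := E 4; rewrite !coefsE.
- by have := E 2; rewrite !coefsE 2!(qC _ 2).
- by have := E 4; rewrite !coefsE 2!(qC _ 2).
- by have := E 5; rewrite !coefsE.
Qed.

(** Evaluation at [v] is a ring morphism, so it commutes with the discriminant and turns the generic
    form into the member of the web with parameters [v]. *)
Lemma discr_generic (fs : 4.-tuple (qform F)) (v : 'rV[F]_4) :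
  (discr (generic_form fs)).@[fun i => v 0 i]
  = dsc (v *m \matrix_i coefs (tnth fs i)).
Proof.
have qE i j : (qcoef (generic_form fs) i j).@[fun i => v 0 i]
   = \sum_k v 0 k * qcoef (tnth fs k) i j.
  rewrite /qcoef /generic_form raddf_sum /= raddf_sum /=; apply: eq_bigr => k _.
  by rewrite mcoeffZ mcoeff_map_mpoly mevalM mevalXU mevalC.
have cE (f : 'I_6) i j : (forall g : {mpoly F[3]}, coefs g 0 f = qcoef g i j) ->
    (qcoef (generic_form fs) i j).@[fun i => v 0 i]
    = (v *m \matrix_i coefs (tnth fs i)) 0 f.
  by move=> h; rewrite qE mxE; apply: eq_bigr => k _; rewrite mxE h.
rewrite /dsc -(cE 0 0 0) -?(cE 1 0 1) -?(cE 2 0 2) -?(cE 3 1 1) -?(cE 4 1 2) -?(cE 5 2 2);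
  try by move=> g; rewrite coefsE.
rewrite /discr.
move: (qcoef _ 0 0) (qcoef _ 0 1) (qcoef _ 0 2) (qcoef _ 1 1) (qcoef _ 1 2) (qcoef _ 2 2).
move=> a00 a01 a02 a11 a12 a22; rewrite !mevalB !mevalD !mevalM.
by rewrite rmorph_nat !expr2.
Qed.

Lemma card_cubic_surface (L : {vspace 'rV[F]_6}) (fs : 4.-tuple (qform F)) :
  \dim L = 2%N -> basis_of (web L) fs ->
  #|cubic_surface fs|
  = (q ^ 2 + q * #|ppoints L :&: secant_variety F| + 1)%N.
Proof.
move=> hL /andP[/eqP fs_span fs_free].
have [ys /andP[/eqP ys_span ys_free]] : exists ys : 2.-tuple 'rV[F]_6, basis_of L ys.
  by exists (tcast hL (vbasis L)); rewrite val_tcast; apply: vbasisP.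
pose Y := \matrix_(i < 2) ys`_i : 'M[F]_(2, 6).
have YE (c : 'rV_2) : c *m Y = \sum_i c 0 i *: ys`_i.
  by rewrite mulmx_sum_row; apply: eq_bigr => i _; rewrite rowK.
have Y0 (c : 'rV_2) : c *m Y = 0 -> c = 0.
  rewrite YE => /(elimT freeP ys_free (fun i => c 0 i)) c0.
  by apply/rowP => i; rewrite mxE.
have Yinj : injective (fun c : 'rV_2 => c *m Y).
  move=> c d /eqP; rewrite -subr_eq0 -mulmxBl => /eqP/Y0/eqP.
  by rewrite subr_eq0 => /eqP.
have Yfree : row_free Y.
  rewrite -kermx_eq0; apply/eqP/row_matrixP => i.
  by rewrite row0 (Y0 (row i _)) // -row_mul mulmx_ker row0.
have memL y : reflect (exists c : 'rV_2, y = c *m Y) (y \in L).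
  rewrite -ys_span; apply: (iffP idP) => [/coord_span->|[c ->]].
    by exists (\row_i coord ys i y); rewrite YE; apply: eq_bigr => i _; rewrite mxE.
  rewrite YE; apply: memv_suml => i _.
  by rewrite memvZ // memv_span // mem_nth // size_tuple.
pose C := \matrix_(i < 4) coefs (tnth fs i).
have CE (v : 'rV_4) : v *m C = coefs (\sum_i v 0 i *: tnth fs i : qform F).
  by rewrite coefs_sum.
have C0 (v : 'rV_4) : v *m C = 0 -> v = 0.
  rewrite CE => e; have : \sum_(i < 4) v 0 i *: fs`_i = 0.
    rewrite (eq_bigr (fun i => v 0 i *: tnth fs i)) => [|i _]; last first.
      by rewrite (tnth_nth 0).
    apply: coefs_inj; rewrite e; apply/rowP; apply: forall_ord6;
      by rewrite coefsE /qcoef mcoeff0 mxE.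
  by move/(elimT freeP fs_free (fun i => v 0 i)) => v0; apply/rowP => i; rewrite mxE.
have Cinj : injective (fun v : 'rV_4 => v *m C).
  move=> c d /eqP; rewrite -subr_eq0 -mulmxBl => /eqP/C0/eqP.
  by rewrite subr_eq0 => /eqP.
(* The forms of the given basis lie in the web and are independent, so equal cardinality q^4 gives
   all of it. *)
have CW : [set v *m C | v : 'rV_4] = [set a | a *m Y^T == 0].
  apply/eqP; rewrite eqEcard card_web // card_imset // card_mx mul1n leqnn andbT.
  apply/subsetP => _ /imsetP[v _ ->]; rewrite inE CE.
  have : \sum_i v 0 i *: tnth fs i \in web L.
    by rewrite -fs_span memv_suml // => i _; rewrite memvZ // memv_span // mem_tnth.
  move/mem_web => fL; apply/eqP/rowP => j.
  have /fL : ys`_j \in L by rewrite -ys_span memv_span // mem_nth // size_tuple.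
  rewrite hypeval_coefs !mxE => e; rewrite -[RHS]e.
  by apply: eq_bigr => k _; rewrite !mxE.
have q1 : (0 < q.-1)%N by have := card_finNzRing_gt1 F; case: q.
(* Multiplying by q - 1 passes from points to nonzero vectors, on the surface and on the line
   alike. *)
apply/eqP; rewrite -(eqn_pmul2l q1); apply/eqP.
have surf : (q.-1 * #|cubic_surface fs|)%N
   = #|[set a | a *m Y^T == 0 & (a != 0) && (dsc a == 0)]|.
  rewrite /cubic_surface /zero_locus -card_ppoints; last first.
    move=> a v a0; rewrite !discr_generic => /eqP Dv.
    by rewrite -scalemxAl dscZ Dv mulr0.
  rewrite -(card_imset _ Cinj); apply: eq_card => a; rewrite [RHS]inE.
  have -> : (a *m Y^T == 0) = (a \in [set v *m C | v : 'rV_4]) by rewrite CW inE.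
  apply/imsetP/andP => [[v]|[/imsetP[v _ ->]]].
    rewrite inE discr_generic -/C => /andP[v0 Dv] ->; split; first exact: imset_f.
    by rewrite Dv andbT; apply: contra_neq v0 => /C0.
  move=> /andP[v0 Dv]; exists v => //; rewrite inE discr_generic Dv andbT.
  by apply: contra_neq v0 => ->; rewrite mul0mx.
rewrite surf ppoints_secant !mulnDr (mulnCA _ q) -card_ppoints; last first.
  move=> a y a0 /andP[yL /eqP Dy]; rewrite memvZ //=.
  have -> : symmx (a *: y) = a *: symmx y by apply/matrixP => i j; rewrite !mxE.
  by rewrite detZ Dy mulr0.
rewrite (card_discriminant Yfree) mulnDr addnAC; congr (_ + _ * _ + _)%N.
rewrite -(card_imset _ Yinj); apply: eq_card => y; rewrite [RHS]inE.
apply/imsetP/and3P => [[c]|[y0 /memL[c yc] Dy]].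
  rewrite inE => /andP[c0 Dc] ->; split=> //; last by apply/memL; exists c.
  by apply: contra_neq c0 => /Y0.
exists c => //; rewrite inE -yc Dy andbT.
by apply: contra_neq y0 => c0; rewrite yc c0 mul0mx.
Qed.
End Web.

Local Close Scope ring_scope.

Theorem theorem4p31 (q : nat) (F : finFieldType) (hF : #|F| = q)
  (L : {vspace 'rV[F]_6}) (hL : \dim L = 2)
  (fs : 4.-tuple (qform F)) (hfs : basis_of (web L) fs)
  (i : nat) (hi : i \in [:: 0; 1; 2; 3; q.+1]) :
  #|ppoints L :&: secant_variety F| = i <->
  #|cubic_surface fs| = q ^ 2 + i * q + 1.
Proof.
rewrite (card_cubic_surface hL hfs) hF mulnC.
have q0 : (0 < q)%N by rewrite -hF; apply/card_gt0P; exists 0%R.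
(* As q is positive, the value of q^2 + i q + 1 determines i. *)
split=> [->//|/eqP]; rewrite eqn_add2r eqn_add2l eqn_pmul2r //; exact/eqP.
Qed.
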